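(* Let $M$ be a smooth manifold of even dimension $n=2m\ge 2$, let $\nabla$ be a connection on $TM$, and let $J^\nabla$ be the almost complex structure it defines on the bundle $J(M)$ of all endomorphisms $j$ of tangent spaces of $M$ with $j^2=-1$. If $J^\nabla$ is integrable, then there is another connection $\nabla'$ on $TM$ which has zero torsion and defines the same almost complex structure on $J(M)$, i.e. $J^{\nabla'}=J^\nabla$.
   Context: Connections are smooth linear connections on the tangent bundle $TM$. The torsion of $\nabla$ is $T^\nabla(X,Y)=\nabla_XY-\nabla_YX-[X,Y]$. An almost complex structure is integrable if its Nijenhuis tensor vanishes (equivalently, it comes from a complex manifold structure). The almost complex structure $J^\nabla$: $J(M)$ is the bundle over $M$ whose fibre at $x$ is $\{j\in\mathrm{End}(T_xM): j^2=-1\}$, with projection $\pi:J(M)\to M$. Let $E=\pi^*TM$, so $d\pi$ is a surjective bundle map $TJ(M)\to E$, with kernel the vertical bundle $\mathcal V$; at $j\in J(M)$ the space $\mathcal V_j$ is identified with the endomorphisms of $E_j=T_{\pi(j)}M$ which anticommute with $j$. The bundle $\mathrm{End}(E)$ has the canonical section $\mathcal J$ given by $\mathcal J_j=j$. A connection $\nabla$ on $TM$ induces the pull-back connection $\pi^*\nabla$ on $E$ (and on $\mathrm{End}(E)$), and $\pi^*\nabla\mathcal J$ is an $\mathrm{End}(E)$-valued $1$-form on $J(M)$ with values anticommuting with $\mathcal J$; as a map $TJ(M)\to\mathcal V$ it is surjective, and its kernel is mapped isomorphically onto $E$ by $d\pi$. $J^\nabla$ is the unique almost complex structure on $J(M)$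 such that for all tangent vectors $X$ to $J(M)$ $$d\pi(J^\nabla X)=\mathcal J\,d\pi(X),\qquad (\pi^*\nabla)_{J^\nabla X}\mathcal J=\mathcal J\,(\pi^*\nabla)_X\mathcal J .$$ *)

(* Defs.v *)
From HB Require Import structures.
From mathcomp Require Import all_boot all_order all_algebra.
From mathcomp Require Import all_classical all_reals all_analysis.

Set Implicit Arguments.
Unset Strict Implicit.
Unset Printing Implicit Defensive.

Import Order.TTheory GRing.Theory Num.Theory.
Import numFieldNormedType.Exports.

Local Open Scope classical_set_scope.
Local Open Scope ring_scope.

(* C^k and C^oo through iterated Frechet derivatives; only used between
   finite-dimensional spaces, where fixing the direction v is harmless. *)
Fixpoint Ck_on (R : realType) (V W : normedModType R) (k : nat)
    (U : set V) (f : V -> W) : Prop :=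
  match k with
  | 0 => forall x, U x -> {for x, continuous f}
  | k'.+1 => (forall x, U x -> differentiable f x) /\
             (forall v, Ck_on k' U (fun x => 'd f x v))
  end.

Definition smooth_on (R : realType) (V W : normedModType R)
    (U : set V) (f : V -> W) : Prop :=
  forall k, Ck_on k U f.

Definition smooth_near (R : realType) (V W : normedModType R)
    (x : V) (f : V -> W) : Prop :=
  exists U : set V, [/\ open U, U x & smooth_on U f].

Definition jac (R : realType) (n : nat)
    (f : 'cV[R]_n -> 'cV[R]_n) (x : 'cV[R]_n) : 'M[R]_n :=
  \matrix_(i, k) ('d f x (delta_mx k 0)) i 0.

Record chart (R : realType) (n : nat) (T : topologicalType) := Chart {
  cdom : set T;
  cfwd : T -> 'cV[R]_n;
  cbwd : 'cV[R]_n -> T;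
  cdom_open : open cdom;
  cimg_open : open (cfwd @` cdom);
  cfwdK : forall x, cdom x -> cbwd (cfwd x) = x;
  cfwd_cont : forall x, cdom x -> {for x, continuous cfwd};
  cbwd_cont : forall y, (cfwd @` cdom) y -> {for y, continuous cbwd} }.

(* A smooth manifold of dimension n, given by an atlas.  [pref x] is a chosen
   chart of the atlas around x. *)
Record manifold (R : realType) (n : nat) := Manifold {
  mpt :> topologicalType;
  mhausdorff : hausdorff_space mpt;
  mcountable : @second_countable mpt;
  midx : Type;
  mchart : midx -> chart R n mpt;
  pref : mpt -> midx;
  prefP : forall x, cdom (mchart (pref x)) x;
  mcompat : forall a b : midx,
    smooth_on (cfwd (mchart a) @` (cdom (mchart a) `&` cdom (mchart b)))
              (cfwd (mchart b) \o cbwd (mchart a)) }.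

Section manifold_defs.
Context {R : realType} {n : nat} (M : manifold R n).

Definition crd (a : midx M) : M -> 'cV[R]_n := cfwd (mchart a).
Definition pcrd (x : M) : 'cV[R]_n := crd (pref x) x.

Definition trans (a b : midx M) : 'cV[R]_n -> 'cV[R]_n :=
  crd b \o cbwd (mchart a).

Definition dtrans (a b : midx M) (y : 'cV[R]_n) : 'M[R]_n := jac (trans a b) y.

(* The tangent space T_xM is R^n, a vector being represented by its components
   in the chart [pref x]; thus End(T_xM) is the algebra of n x n matrices acting
   on columns.  [tcomp a x v] gives the components in the chart a of the tangent
   vector v at x. *)
Definition tcomp (a : midx M) (x : M) (v : 'cV[R]_n) : 'cV[R]_n :=
  dtrans (pref x) a (pcrd x) *m v.

(* A (local) vector field is a total function whose values matter only near
   the point considered. *)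
Definition vfield : Type := M -> 'cV[R]_n.

Definition fun_loc (W : Type) (x : M) (f : M -> W) : 'cV[R]_n -> W :=
  f \o cbwd (mchart (pref x)).

Definition vf_loc (x : M) (Y : vfield) : 'cV[R]_n -> 'cV[R]_n :=
  fun_loc x (fun y => tcomp (pref x) y (Y y)).

Definition fun_smooth_at (x : M) (f : M -> R) : Prop :=
  smooth_near (pcrd x) (fun_loc x f : 'cV[R]_n -> R^o).

Definition vf_smooth_at (x : M) (Y : vfield) : Prop :=
  smooth_near (pcrd x) (vf_loc x Y).

Definition dfun (x : M) (v : 'cV[R]_n) (f : M -> R) : R :=
  'd (fun_loc x f : 'cV[R]_n -> R^o) (pcrd x) v.

Definition bracket (X Y : vfield) : vfield := fun x =>
  'd (vf_loc x Y) (pcrd x) (X x) - 'd (vf_loc x X) (pcrd x) (Y x).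

(* The i-th coordinate vector field of the chart a. *)
Definition frame (a : midx M) (i : 'I_n) : vfield := fun y =>
  dtrans a (pref y) (crd a y) *m delta_mx i 0.

(* [cov x v Y] is the covariant derivative at x, in the direction v in T_xM, of
   a vector field Y smooth near x.  As f need only be smooth near x in
   [cov_leibniz], taking for f the indicator function of a neighbourhood of x
   shows that [cov x v Y] depends only on the germ of Y at x. *)
Record connection := Connection {
  cov : forall x : M, 'cV[R]_n -> vfield -> 'cV[R]_n;
  cov_linear : forall x (Y : vfield), vf_smooth_at x Y ->
    forall (c : R) u v, cov x (c *: u + v) Y = c *: cov x u Y + cov x v Y;
  cov_add : forall x v (Y Z : vfield), vf_smooth_at x Y -> vf_smooth_at x Z ->
    cov x v (fun y => Y y + Z y) = cov x v Y + cov x v Z;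
  cov_leibniz : forall x v (f : M -> R) (Y : vfield),
    fun_smooth_at x f -> vf_smooth_at x Y ->
    cov x v (fun y => f y *: Y y) = dfun x v f *: Y x + f x *: cov x v Y;
  cov_smooth : forall x (X Y : vfield), vf_smooth_at x X -> vf_smooth_at x Y ->
    vf_smooth_at x (fun y => cov y (X y) Y) }.

Definition torsion (D : connection) (X Y : vfield) : vfield := fun x =>
  cov D x (X x) Y - cov D x (Y x) X - bracket X Y x.

Definition torsion_free (D : connection) : Prop :=
  forall x (X Y : vfield), vf_smooth_at x X -> vf_smooth_at x Y ->
    torsion D X Y x = 0.

(* The points of J(M), regarded as an embedded submanifold of the total space
   of End(TM). *)
Record JM := JPoint {
  jpi : M;
  jend : 'M[R]_n;
  jendP : jend *m jend == - 1%:M }.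

Definition jmod : normedModType R := ('cV[R]_n * 'M[R]_n)%type.

(* Transition maps of the charts of End(TM) induced by those of M. *)
Definition etrans (a b : midx M) (z : jmod) : jmod :=
  (trans a b z.1,
   dtrans a b z.1 *m z.2 *m dtrans b a (trans a b z.1)).

Definition jpcrd (p : JM) : jmod := (pcrd (jpi p), jend p).

Definition jcrd (a : midx M) (p : JM) : jmod :=
  etrans (pref (jpi p)) a (jpcrd p).

(* The tangent space to J(M) at p, as a subspace of the tangent space to
   End(TM), in the chart [pref (jpi p)]. *)
Definition jtangent (p : JM) : set jmod :=
  [set X | jend p *m X.2 + X.2 *m jend p = 0].

(* Smooth functions on a submanifold are those which extend locally to smooth
   functions on the ambient space; F is such an extension of f near p, read in
   the chart [pref (jpi p)]. *)
Definition jextends (W : normedModType R) (p : JM) (f : JM -> W)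
    (F : jmod -> W) : Prop :=
  exists O : set jmod, [/\ open O, O (jpcrd p), smooth_on O F &
    forall q : JM, cdom (mchart (pref (jpi p))) (jpi q) ->
      O (jcrd (pref (jpi p)) q) -> f q = F (jcrd (pref (jpi p)) q)].

Definition jsmooth_at (W : normedModType R) (p : JM) (f : JM -> W) : Prop :=
  exists F, jextends p f F.

(* The derivative at p of a smooth function along X in T_pJ(M); it does not
   depend on the chosen extension since X is tangent to J(M). *)
Definition jder (W : normedModType R) (p : JM) (X : jmod) (f : JM -> W) : W :=
  'd (xget (fun=> 0) [set F | jextends p f F] : jmod -> W) (jpcrd p) X.

Definition jvfield : Type := JM -> jmod.

(* Components of the vector field X in the chart of End(TM) induced by a. *)
Definition jvf_comp (a : midx M) (X : jvfield) (q : JM) : jmod :=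
  'd (etrans (pref (jpi q)) a) (jpcrd q) (X q).

Definition jvf_smooth_at (p : JM) (X : jvfield) : Prop :=
  (forall q, jtangent q (X q)) /\
  jsmooth_at p (jvf_comp (pref (jpi p)) X).

Definition jbracket (X Y : jvfield) : jvfield := fun p =>
  jder p (X p) (jvf_comp (pref (jpi p)) Y)
  - jder p (Y p) (jvf_comp (pref (jpi p)) X).

(* Values of a field of endomorphisms of TJ(M) outside [jtangent] are junk. *)
Definition jendfield : Type := JM -> jmod -> jmod.

Definition nijenhuis (I : jendfield) (X Y : jvfield) : jvfield := fun p =>
  let IX : jvfield := fun q => I q (X q) in
  let IY : jvfield := fun q => I q (Y q) in
  jbracket IX IY p - I p (jbracket IX Y p) - I p (jbracket X IY p)
  - jbracket X Y p.

Definition nijenhuis_integrable (I : jendfield) : Prop :=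
  forall p (X Y : jvfield), jvf_smooth_at p X -> jvf_smooth_at p Y ->
    nijenhuis I X Y p = 0.

(* d pi, in charts of End(TM) for which pi is the first projection. *)
Definition dpi (X : jmod) : 'cV[R]_n := X.1.

(* Sections of E = pi^* TM and of End(E). *)
Definition Esection : Type := JM -> 'cV[R]_n.
Definition EndEsection : Type := JM -> 'M[R]_n.

Definition pull (Y : vfield) : Esection := fun q => Y (jpi q).

(* The pull-back connection on E: if s = \sum_i s_i pi^*e_i, where (e_i) is the
   coordinate frame of [pref (jpi p)], its derivative along X at p is
   \sum_i (X s_i) e_i + s_i cov_(dpi X) e_i. *)
Definition pb_cov (D : connection) (p : JM) (X : jmod) (s : Esection) :
    'cV[R]_n :=
  let a := pref (jpi p) in
  jder p X (fun q => tcomp a (jpi q) (s q))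
  + \sum_(i < n) (s p i 0) *: cov D (jpi p) (dpi X) (frame a i).

(* The induced connection on End(E), (D_X Phi) s = D_X (Phi s) - Phi (D_X s),
   evaluated on the frame (pi^*e_i); the result is the matrix of the
   endomorphism of T_(pi p)M. *)
Definition pb_cov_End (D : connection) (p : JM) (X : jmod)
    (Phi : EndEsection) : 'M[R]_n :=
  \matrix_(k, i)
    (let s := pull (frame (pref (jpi p)) i) in
     pb_cov D p X (fun q => Phi q *m s q) - Phi p *m pb_cov D p X s) k 0.

Definition tautJ : EndEsection := jend.

Definition is_Jnabla_at (D : connection) (p : JM) (X X' : jmod) : Prop :=
  [/\ jtangent p X',
      dpi X' = tautJ p *m dpi X &
      pb_cov_End D p X' tautJ = tautJ p *m pb_cov_End D p X tautJ].

(* J^D X is the unique tangent vector satisfying [is_Jnabla_at]. *)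
Definition Jnabla (D : connection) : jendfield := fun p X =>
  xget 0 [set X' | is_Jnabla_at D p X X'].

End manifold_defs.

Arguments connection {R n} M.
Arguments jmod : clear implicits.

(* Main.v *)
From HB Require Import structures.
From mathcomp Require Import all_boot all_order all_algebra all_fingroup.
From mathcomp Require Import all_classical all_reals all_analysis.
From mathcomp Require Import ring lra zify.
Require Import Defs.

(* In the chart of a point x, J^D sends (w, A) in T_(x,j)J(M) to (j w, A') with
   A' + [G(jw), j] = j (A + [G(w), j]), where G is the Christoffel matrix of D.
   For the horizontal lifts of the constant fields u and v, the component in TM
   of the Nijenhuis tensor of J^D at (x, j) is
     T(u, v) - T(ju, jv) + j T(ju, v) + j T(u, jv),
   T being the torsion of D at x. If it vanishes for all j, then applying it to
   the j which map e_a to s e_c and e_b to r e_d, for distinct a, b, c, d and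
   several s, r, shows that T(u, v) = alpha(u) v - alpha(v) u, where (n - 1) alpha
   is the trace of T. Then D - alpha (x) Id has no torsion, and defines the same
   J^D since alpha(w) Id commutes with j. *)

Set Implicit Arguments.
Unset Strict Implicit.
Unset Printing Implicit Defensive.

Import Order.TTheory GRing.Theory Num.Theory.
Import numFieldNormedType.Exports.

Local Open Scope classical_set_scope.
Local Open Scope ring_scope.

(** * Differentials and smooth maps *)

(** Each tangent space is read in the chart [pref x], which may jump from point to point, so nothing
    can be differentiated before it is rewritten in one chart kept fixed near the point. Hence the
    change-of-chart laws for Christoffel matrices, horizontal lifts and torsion. In particular alpha
    is defined pointwise, and its smoothness rests on the torsion being a tensor; this is where the
    symmetry of second derivatives enters. Horizontal lifts are good test fields because J^D sends
    the lift of w to the lift of jw: all four brackets are between horizontal fields, and their TM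
    component involves first derivatives of sections of E only, with no curvature. Four distinct
    indices exist only if n >= 4. Three distinct indices force this because n is even; for n = 2
    every alternating T already has the form alpha(u) v - alpha(v) u. *)

Section calculus.
Context {R : realType}.

Lemma is_diff_near_eq (V W : normedModType R) (f g : V -> W) (x : V)
    (df : V -> W) :
  {near x, f =1 g} -> is_diff x f df -> is_diff x g df.
Proof.
move=> fg dfx.
(* [g - f] vanishes near [x], hence is little-o of the increment; the sum rule is then applied to
   [g = f + (g - f)]. *)
have d0 : is_diff x (g - f) 0.
  have E : (g - f) \o shift x = cst ((g - f) x) + (0 : V -> W) +o_ (0 : V) id.
    apply/eqaddoP => e e0.
    have fgx : f x = g x := nbhs_singleton fg.
    have : \forall y \near (0 : V), f (y + x) = g (y + x).
      by move: fg; rewrite (near_shift 0 x) /=; apply: filterS => y; rewrite subr0.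
    apply: filterS => y fgy.
    have -> : ((g - f) \o shift x - (cst ((g - f) x) + 0)) y = 0.
      by rewrite !fctE /= fgy fgx !subrr addr0 subrr.
    by rewrite normr0 mulr_ge0 // ltW.
  pose L0 : {linear V -> W} := \0.
  have L0c : continuous L0 by move=> z; exact: cvg_cst.
  have Ed : 'd (g - f) x = L0 :> (V -> W) by exact: diff_unique L0c E.
  by split; [apply/diff_locallyP; rewrite Ed; split | rewrite Ed].
have -> : g = f + (g - f) by rewrite addrC subrK.
by rewrite -[df]addr0; apply: is_diffD.
Qed.

Lemma is_diffW (V W : normedModType R) (f df df' : V -> W) (x : V) :
  df =1 df' -> is_diff x f df -> is_diff x f df'.
Proof. by move=> /funext ->. Qed.

Lemma is_diff_bilin (V U1 U2 W : normedModType R)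
    (b : {bilinear U1 -> U2 -> W}) (f df : V -> U1) (g dg : V -> U2) (x : V) :
  continuous (fun p : U1 * U2 => b p.1 p.2) ->
  is_diff x f df -> is_diff x g dg ->
  is_diff x (fun y => b (f y) (g y)) (fun v => b (f x) (dg v) + b (df v) (g x)).
Proof.
move=> bc dfx dgx.
have db : is_diff (f x, g x) (fun p : U1 * U2 => b p.1 p.2)
    (fun q => b (f x) q.2 + b q.1 (g x)).
  by split; [exact: differentiable_bilin | rewrite diff_bilin].
have dp := is_diff_pair dfx dgx.
exact: (is_diff_comp dp db).
Qed.

Lemma is_diff_lin (V W : normedModType R) (L : {linear V -> W}) (x : V) :
  continuous L -> is_diff x L L.
Proof. by move=> Lc; split; [exact: linear_differentiable|rewrite diff_lin]. Qed.

Lemma is_diff_linl (V U W : normedModType R) (L : {linear U -> W})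
    (f df : V -> U) (x : V) :
  continuous L -> is_diff x f df ->
  is_diff x (fun y => L (f y)) (fun v => L (df v)).
Proof. by move=> Lc dfx; exact: (is_diff_comp dfx (is_diff_lin (f x) Lc)). Qed.

Lemma continuous_fsum (T : topologicalType) (W : normedModType R) (I : Type)
    (r : seq I) (F : I -> T -> W) (x : T) :
  (forall i, {for x, continuous (F i)}) ->
  {for x, continuous (fun y => \sum_(i <- r) F i y)}.
Proof.
move=> Fc; elim: r => [|i r IH].
  rewrite (_ : (fun y => _) = cst 0); first exact: cvg_cst.
  by apply/funext => y; rewrite big_nil.
rewrite (_ : (fun y => _) = (fun y => F i y + \sum_(j <- r) F j y)); last first.
  by apply/funext => y; rewrite big_cons.
exact: continuousD (Fc i) IH.
Qed.

Lemma continuous_mxP (T : topologicalType) (p q : nat) (F : T -> 'M[R]_(p, q))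
    (x : T) :
  (forall i j, {for x, continuous (fun y => F y i j : R^o)}) ->
  {for x, continuous F}.
Proof.
move=> Fc.
rewrite (_ : F = fun y => \sum_i \sum_j F y i j *: delta_mx i j); last first.
  by apply/funext => y; rewrite {1}[F y]matrix_sum_delta.
do 2 (apply: continuous_fsum => ?).
by apply: continuousZ; [exact: Fc|exact: cvg_cst].
Qed.

Lemma linear_mx_continuous (W : normedModType R) (p q : nat)
    (L : {linear 'M[R]_(p, q) -> W}) : continuous L.
Proof.
move=> A; rewrite (_ : L = (fun B => \sum_i \sum_j B i j *: L (delta_mx i j)) :> (_ -> _)).
  do 2 (apply: continuous_fsum => ?).
  apply: continuousZ; first exact: coord_continuous.
  exact: (@cst_continuous _ W).
apply/funext => B; rewrite {1}[B]matrix_sum_delta linear_sum.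
by apply: eq_bigr => i _; rewrite linear_sum; apply: eq_bigr => j _; rewrite linearZ.
Qed.

Lemma mulmx_continuous (p q r : nat) :
  continuous (fun AB : 'M[R]_(p, q) * 'M[R]_(q, r) => AB.1 *m AB.2).
Proof.
move=> AB; apply: continuous_mxP => i j.
rewrite (_ : (fun y => _) =
  fun y : 'M[R]_(p, q) * 'M[R]_(q, r) => \sum_k (y.1 i k * y.2 k j : R^o)); last first.
  by apply/funext => y; rewrite mxE.
apply: continuous_fsum => k; apply: (@continuousM R).
  apply: (@continuous_comp _ _ _ fst (fun A : 'M[R]_(p, q) => A i k : R)).
    exact: cvg_fst.
  exact: coord_continuous.
apply: (@continuous_comp _ _ _ snd (fun A : 'M[R]_(q, r) => A k j : R)).
  exact: cvg_snd.
exact: coord_continuous.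
Qed.

End calculus.

(** * Closure rules for [Ck_on], and inverse matrices *)

Section smooth.
Context {R : realType}.
Implicit Types V W : normedModType R.

Lemma is_diff_inj V W (f df dg : V -> W) (x : V) :
  is_diff x f df -> is_diff x f dg -> df =1 dg.
Proof. by move=> [_ <-] [_ <-]. Qed.

Lemma Ck_on_sub V W k (U U' : set V) (f : V -> W) :
  U' `<=` U -> Ck_on k U f -> Ck_on k U' f.
Proof.
move=> UU'; elim: k f => [|k IH] f /=; first by move=> fc x /UU'/fc.
by move=> [fd fk]; split=> [x /UU'/fd //|v]; apply: IH.
Qed.

Lemma Ck_on_pred V W k (U : set V) (f : V -> W) :
  Ck_on k.+1 U f -> Ck_on k U f.
Proof.
elim: k f => [|k IH] f [fd fk]; first by move=> x /fd/differentiable_continuous.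
by split=> // v; apply: IH.
Qed.

Lemma Ck_on_eq V W k (U : set V) (f g : V -> W) :
  open U -> {in U, f =1 g} -> Ck_on k U f -> Ck_on k U g.
Proof.
move=> Uo; elim: k f g => [|k IH] f g fg /=.
  move=> fc x Ux; have fgx : {near x, f =1 g}.
    by near=> y; apply: fg; rewrite inE; near: y; exact: open_nbhs_nbhs.
  rewrite /prop_for /continuous_at -(fg x) ?inE//.
  exact: (cvg_trans (near_eq_cvg fgx) (fc x Ux)).
move=> [fd fk].
have dg x : U x -> is_diff x g ('d f x).
  move=> Ux; apply: is_diff_near_eq (differentiableP (fd x Ux)).
  by near=> y; apply: fg; rewrite inE; near: y; exact: open_nbhs_nbhs.
split=> [x Ux|v]; first by have := dg x Ux.
by apply: (IH _ _ _ (fk v)) => x /[!inE] Ux; have /@diff_val -> := dg x Ux.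
Unshelve. all: by end_near. Qed.

(** [Ck_on] is phrased with the canonical ['d f]; on an open set an explicit family [df] of
    differentials may replace it. This is the successor step of the inductions on [k] below. *)
Lemma Ck_onS V W k (U : set V) (f : V -> W) (df : V -> V -> W) :
  open U -> (forall x, U x -> is_diff x f (df x)) ->
  (forall v, Ck_on k U (fun x => df x v)) -> Ck_on k.+1 U f.
Proof.
move=> Uo dfx dfk; split=> [x Ux|v]; first by have := dfx x Ux.
by apply: Ck_on_eq Uo _ (dfk v) => x /[!inE] Ux; have /@diff_val -> := dfx x Ux.
Qed.

Lemma Ck_on_diff V W k (U : set V) (f : V -> W) x :
  Ck_on k.+1 U f -> U x -> is_diff x f ('d f x).
Proof. by move=> [fd _] /fd/differentiableP. Qed.

Lemma Ck_on_cst V W k (U : set V) (c : W) : open U -> Ck_on k U (fun=> c).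
Proof.
move=> Uo; elim: k c => [|k IH] c; first by move=> x _; exact: cvg_cst.
by apply: (@Ck_onS _ _ _ _ _ (fun=> 0)) => //; exact: IH.
Qed.

Lemma Ck_onD V W k (U : set V) (f g : V -> W) : open U ->
  Ck_on k U f -> Ck_on k U g -> Ck_on k U (fun x => f x + g x).
Proof.
move=> Uo; elim: k f g => [|k IH] f g.
  by move=> fc gc x Ux; apply: continuousD; [exact: fc|exact: gc].
move=> fk gk; apply: (@Ck_onS _ _ _ _ _ (fun x v => 'd f x v + 'd g x v)) => // [x Ux|v].
  exact: (is_diffD (Ck_on_diff fk Ux) (Ck_on_diff gk Ux)).
by apply: IH; [apply: fk.2|apply: gk.2].
Qed.

Lemma Ck_on_lin V (W' W : normedModType R) (L : {linear W' -> W}) k (U : set V)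
    (f : V -> W') :
  open U -> continuous L -> Ck_on k U f -> Ck_on k U (fun x => L (f x)).
Proof.
move=> Uo Lc; elim: k f => [|k IH] f.
  by move=> fc x Ux; apply: (continuous_comp (fc x Ux)); exact: Lc.
move=> fk; apply: (@Ck_onS _ _ _ _ _ (fun x v => L ('d f x v))) => // [x Ux|v].
  by apply: is_diff_linl Lc _; exact: Ck_on_diff fk Ux.
by apply: IH; apply: fk.2.
Qed.

Lemma Ck_on_comp_lin (V' V W : normedModType R) (L : {linear V' -> V}) k
    (U : set V) (f : V -> W) :
  open U -> continuous L -> Ck_on k U f -> Ck_on k (L @^-1` U) (fun x => f (L x)).
Proof.
move=> Uo Lc; have LUo : open (L @^-1` U) by apply: open_comp => // x _; exact: Lc.
elim: k f => [|k IH] f.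
  by move=> fc x Ux; apply: (continuous_comp (Lc x)); exact: fc.
move=> fk; apply: (@Ck_onS _ _ _ _ _ (fun x v => 'd f (L x) (L v))) => // [x Ux|v].
  exact: (is_diff_comp (is_diff_lin x Lc) (Ck_on_diff fk Ux)).
by apply: (IH (fun x => 'd f x (L v))); apply: fk.2.
Qed.

Lemma Ck_on_bilin V (U1 U2 W : normedModType R) (b : {bilinear U1 -> U2 -> W})
    k (U : set V) (f : V -> U1) (g : V -> U2) :
  open U -> continuous (fun p : U1 * U2 => b p.1 p.2) ->
  Ck_on k U f -> Ck_on k U g -> Ck_on k U (fun x => b (f x) (g x)).
Proof.
move=> Uo bc; elim: k f g => [|k IH] f g.
  move=> fc gc x Ux.
  apply: (@continuous_comp _ _ _ (fun y => (f y, g y)) (fun p => b p.1 p.2)).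
    by apply: cvg_pair; [exact: fc|exact: gc].
  exact: bc.
move=> fk gk.
apply: (@Ck_onS _ _ _ _ _ (fun x v => b (f x) ('d g x v) + b ('d f x v) (g x))) => //.
  by move=> x Ux; apply: is_diff_bilin bc _ _; [exact: Ck_on_diff fk Ux|exact: Ck_on_diff gk Ux].
by move=> v; apply: Ck_onD => //; apply: IH; do ?[exact: Ck_on_pred]; [apply: gk.2|apply: fk.2].
Qed.

Lemma Ck_on_pair V (W1 W2 : normedModType R) k (U : set V) (f : V -> W1)
    (g : V -> W2) :
  open U -> Ck_on k U f -> Ck_on k U g -> Ck_on k U (fun x => (f x, g x)).
Proof.
move=> Uo; elim: k f g => [|k IH] f g.
  by move=> fc gc x Ux; apply: cvg_pair; [exact: fc|exact: gc].
move=> fk gk.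
apply: (@Ck_onS _ _ _ _ _ (fun x v => ('d f x v, 'd g x v))) => // [x Ux|v].
  by apply: is_diff_pair; [exact: Ck_on_diff fk Ux|exact: Ck_on_diff gk Ux].
by apply: IH; [apply: fk.2|apply: gk.2].
Qed.

Lemma Ck_on_id V k (U : set V) : open U -> Ck_on k U id.
Proof.
move=> Uo; case: k => [|k]; first by move=> x _.
by apply: (@Ck_onS _ _ _ _ _ (fun=> id)) => // v; exact: Ck_on_cst.
Qed.

Lemma diff_mxinv V n (A B : V -> 'M[R]_n) (x v : V) :
  differentiable A x -> differentiable B x ->
  (\forall y \near x, A y *m B y = 1%:M) ->
  'd B x v = - (B x *m 'd A x v *m B x).
Proof.
move=> Ad Bd AB; have BA := mulmx1C (nbhs_singleton AB).
have d1 := is_diff_bilin (b := mulmx) (@mulmx_continuous _ _ _ _)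
  (differentiableP Ad) (differentiableP Bd).
have d2 : is_diff x (fun y => A y *m B y) 0.
  apply: is_diff_near_eq (is_diff_cst 1%:M x).
  by apply: filterS AB => y ->.
have /= E := is_diff_inj d1 d2 v.
have {}E : A x *m 'd B x v = - ('d A x v *m B x) by apply/eqP; rewrite -addr_eq0 E.
by move: (congr1 (mulmx (B x)) E); rewrite mulmxA BA mul1mx mulmxN mulmxA.
Qed.

(* Since A B = 1 gives dB = - B dA B, the inverse B is as smooth as A. *)
Lemma smooth_on_mxinv V n (U : set V) (A B : V -> 'M[R]_n) :
  open U -> (forall x, U x -> differentiable B x) ->
  (forall x, U x -> A x *m B x = 1%:M) ->
  smooth_on U A -> smooth_on U B.
Proof.
move=> Uo Bd AB As.
have dB x v : U x -> 'd B x v = - (B x *m 'd A x v *m B x).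
  move=> Ux; apply: diff_mxinv; [exact: (As 1).1|exact: Bd|].
  have : \forall y \near x, U y by exact: open_nbhs_nbhs.
  by apply: filterS => y; exact: AB.
elim=> [|k IH]; first by move=> x Ux; exact/differentiable_continuous/Bd.
split=> // v.
apply: (@Ck_on_eq _ _ _ _ (fun x => (-1) *: (B x *m 'd A x v *m B x))) => //.
  move=> x /[!inE] Ux.
  by rewrite scaleN1r; exact/esym/dB.
have sc : continuous (fun M : 'M[R]_n => (-1) *: M) by exact: scaler_continuous.
apply: (Ck_on_lin (L := GRing.scale (-1))) => //.
have mc := @mulmx_continuous R n n n.
apply: (Ck_on_bilin (b := mulmx)) => //.
by apply: (Ck_on_bilin (b := mulmx)) => //; apply: (As k.+1).2.
Qed.

End smooth.

(** * Symmetry of second derivatives *)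

Section schwarz.
Context {R : realType}.

Lemma is_derive_along (V : normedModType R) (f : V -> R^o) (c u : V) (s : R) :
  differentiable f (s *: u + c) ->
  is_derive s 1 (fun r : R => f (r *: u + c) : R) ('d f (s *: u + c) u).
Proof.
move=> fd.
have da : is_diff s (fun r : R => r *: u + c) (fun r : R => r *: u).
  apply: is_diffW (is_diffD (is_diff_scalel s u) (is_diff_cst c s)).
  by move=> r; rewrite fctE addr0.
have dc := is_diff_comp da (differentiableP fd).
have [dd dv] := dc.
apply: DeriveDef; first exact/diff_derivable.
by rewrite deriveE // dv /= scale1r.
Qed.

(** The mean value theorem is applied twice: to [phi] in the direction [u], then to the derivative
    [psi] in the direction [v]. The second difference on the left is symmetric in [u] and [v], so
    exchanging them gives the other mixed derivative at another nearby point. *)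
Lemma second_difference (V : normedModType R) (f : V -> R^o) (U : set V)
    (x u v : V) (r h : R) :
  (ball x r `<=` U) -> 0 < h -> h * (`|u| + `|v|) < r -> Ck_on 2 U f ->
  exists2 xi, ball x r xi &
    f (h *: u + (h *: v + x)) - f (h *: u + x) - (f (h *: v + x) - f x)
    = 'd (fun y => 'd f y u) xi v * h * h.
Proof.
move=> xU h0 hr fk.
have inU s t : 0 <= s <= h -> 0 <= t <= h -> ball x r (s *: u + (t *: v + x)).
  move=> /andP[s0 sh] /andP[t0 th].
  rewrite -ball_normE /ball_ /= addrA opprD addrCA subrr addr0 normrN.
  apply: le_lt_trans hr.
  rewrite (le_trans (ler_normD _ _)) // !normrZ !ger0_norm // mulrDr.
  by rewrite lerD // ler_wpM2r.
have dd s t : 0 <= s <= h -> 0 <= t <= h ->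
    differentiable f (s *: u + (t *: v + x)).
  by move=> sh th; apply: fk.1; apply/xU/inU.
have h1 : 0 <= h <= h by rewrite lexx ltW.
have h2 : 0 <= (0 : R) <= h by rewrite lexx ltW.
pose phi s : R := f (s *: u + (h *: v + x)) - f (s *: u + x).
pose dphi s : R := 'd f (s *: u + (h *: v + x)) u - 'd f (s *: u + x) u.
have dphiP s : s \in `[0, h] -> is_derive s 1 phi (dphi s).
  rewrite in_itv /= => sh; apply: is_deriveB; first exact/is_derive_along/dd.
  by apply: is_derive_along; have := dd s 0 sh h2; rewrite scale0r add0r.
have sub (s : R) : s \in `]0, h[ -> s \in `[0, h].
  by rewrite !in_itv /= => /andP[? ?]; rewrite !ltW.
have phic : {within `[0, h], continuous phi}.
  by apply: derivable_within_continuous => s /dphiP [].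
have [c /sub c0h phiE] := MVT h0 (fun s s0h => dphiP s (sub s s0h)) phic.
have ch : 0 <= c <= h by move: c0h; rewrite in_itv.
pose psi t : R := 'd f (t *: v + (c *: u + x)) u.
pose dpsi t : R := 'd (fun y => 'd f y u) (t *: v + (c *: u + x)) v.
have dpsiP t : t \in `[0, h] -> is_derive t 1 psi (dpsi t).
  rewrite in_itv /= => th; apply: is_derive_along; apply: (fk.2 u).1.
  by apply: xU; rewrite addrCA; exact: inU.
have psic : {within `[0, h], continuous psi}.
  by apply: derivable_within_continuous => s /dpsiP [].
have [d /sub d0h psiE] := MVT h0 (fun s s0h => dpsiP s (sub s s0h)) psic.
have dh : 0 <= d <= h by move: d0h; rewrite in_itv.
exists (d *: v + (c *: u + x)); first by rewrite addrCA; exact: inU.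
move: phiE; rewrite /phi !subr0 !scale0r !add0r => ->.
move: psiE; rewrite /psi /dphi !subr0 scale0r add0r addrCA => ->.
by [].
Qed.

Lemma diff2_sym_scalar (V : normedModType R) (f : V -> R^o) (U : set V) (x u v : V) :
  open U -> U x -> Ck_on 2 U f ->
  'd (fun y => 'd f y u) x v = 'd (fun y => 'd f y v) x u.
Proof.
move=> Uo Ux fk; apply/eqP; rewrite -subr_eq0 -normr_le0.
apply/ler_addgt0Pr => e e0; rewrite add0r.
have c1 : {for x, continuous (fun y => 'd (fun y => 'd f y u) y v)} by exact: ((fk.2 u).2 v).
have c2 : {for x, continuous (fun y => 'd (fun y => 'd f y v) y u)} by exact: ((fk.2 v).2 u).
have e2 : 0 < e / 2 by rewrite divr_gt0.
have /nbhs_ballP [r /= r0 rP] : nbhs x [set y | U y /\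
   (`|'d (fun y => 'd f y u) x v - 'd (fun y => 'd f y u) y v| <= e / 2 /\
    `|'d (fun y => 'd f y v) x u - 'd (fun y => 'd f y v) y u| <= e / 2)].
  apply: filterI; first exact: open_nbhs_nbhs.
  by apply: filterI; [move/cvgrPdist_le : c1 | move/cvgrPdist_le : c2]; exact.
have rU : ball x r `<=` U by move=> y /rP[].
(* The summand 1 keeps the denominator positive and leaves strict room in [hr]. *)
pose h := r / (`|u| + `|v| + 1).
have uv0 : 0 < `|u| + `|v| + 1 by rewrite ltr_wpDl ?addr_ge0.
have h0 : 0 < h by rewrite divr_gt0.
have hr : h * (`|u| + `|v|) < r.
  by rewrite /h mulrAC ltr_pdivrMr // ltr_pM2l // ltrDl.
have hr' : h * (`|v| + `|u|) < r by rewrite addrC.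
have [xi /rP[_ [xi1 _]] E1] := second_difference rU h0 hr fk.
have [et /rP[_ [_ et2]] E2] := second_difference rU h0 hr' fk.
have E : 'd (fun y => 'd f y u) xi v = 'd (fun y => 'd f y v) et u.
  have hh : h != 0 by rewrite gt_eqF.
  apply: (mulIf hh); apply: (mulIf hh); rewrite -E1 -E2.
  rewrite (addrCA (h *: v)) -!addrA; congr (_ + _).
  by rewrite !opprB addrCA [RHS]addrCA; congr (_ + _); exact: addrC.
rewrite (splitr e).
rewrite -(subrKA ('d (fun y => 'd f y u) xi v)).
rewrite (le_trans (ler_normD _ _)) // lerD // E distrC //.
Qed.

Definition mxcoord p q (i : 'I_p) (j : 'I_q) (A : 'M[R]_(p, q)) : R^o := A i j.

Lemma mxcoord_is_linear p q (i : 'I_p) (j : 'I_q) : linear (mxcoord i j).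
Proof. by move=> a A B; rewrite /mxcoord !mxE. Qed.

HB.instance Definition _ p q (i : 'I_p) (j : 'I_q) :=
  GRing.isLinear.Build R 'M[R]_(p, q) R^o _ (mxcoord i j) (mxcoord_is_linear i j).

Lemma mxcoord_continuous p q (i : 'I_p) (j : 'I_q) : continuous (mxcoord i j).
Proof. exact: linear_mx_continuous. Qed.

Lemma diff_mxcoord (V : normedModType R) p q (F : V -> 'M[R]_(p, q)) (x : V) i j v :
  differentiable F x ->
  'd (fun y => F y i j : R^o) x v = 'd F x v i j.
Proof.
move=> Fd.
have /@diff_val E := is_diff_linl (@mxcoord_continuous _ _ i j) (differentiableP Fd).
by have /(congr1 (fun f => f v)) := E.
Qed.

Lemma diff2_sym (V : normedModType R) p q (F : V -> 'M[R]_(p, q)) (U : set V)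
    (x u v : V) :
  open U -> U x -> Ck_on 2 U F ->
  'd (fun y => 'd F y u) x v = 'd (fun y => 'd F y v) x u.
Proof.
move=> Uo Ux Fk; apply/matrixP => i j.
rewrite -!diff_mxcoord; [|exact: (Fk.2 _).1..].
have Fij : Ck_on 2 U (fun y => F y i j : R^o).
  exact: (Ck_on_lin Uo (@mxcoord_continuous _ _ i j) Fk).
(* Taking an entry commutes with the inner differential only on [U]; agreement near [x] is enough
   for the outer one. *)
have sw w : 'd (fun y => 'd F y w i j : R^o) x = 'd (fun y => 'd (fun z => F z i j : R^o) y w) x :> (V -> R^o).
  have d1 : is_diff x (fun y => 'd (fun z => F z i j : R^o) y w) ('d (fun y => 'd (fun z => F z i j : R^o) y w) x).
    by apply: differentiableP; exact: (Fij.2 _).1.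
  have eqd : {near x, (fun y => 'd (fun z => F z i j : R^o) y w) =1
      (fun y => 'd F y w i j : R^o)}.
    have : \forall y \near x, U y by exact: open_nbhs_nbhs.
    by apply: filterS => y Uy; apply: diff_mxcoord; exact: Fk.1.
  by have [_] := is_diff_near_eq eqd d1.
by rewrite !sw; exact: diff2_sym_scalar Fij.
Qed.

End schwarz.

(* Stands for ['d f x v] where the latter would be a rewriting redex: its head
   is the coercion of a linear map, which makes unification explode. *)
Definition dir_diff (R : realType) (V W : normedModType R) (f : V -> W)
    (x v : V) : W := 'd f x v.

(** * Closure rules for smooth maps, on open sets and near a point *)

Section smooth_closure.
Context {R : realType}.
Implicit Types V W : normedModType R.

Lemma is_diff_dir_diff V W (f : V -> W) x :
  differentiable f x -> is_diff x f (dir_diff f x).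
Proof. exact: differentiableP. Qed.

Lemma dir_diff_val V W (f df : V -> W) x v :
  is_diff x f df -> dir_diff f x v = df v.
Proof. by move=> [_ <-]. Qed.

Lemma scale_is_bilinear W : bilinear_for
    (GRing.Scale.Law.clone _ _ *:%R _) (GRing.Scale.Law.clone _ _ *:%R _)
    (@GRing.scale R W : R^o -> W -> W).
Proof.
split=> [u'|u] a x y /=; first by rewrite scalerDl scalerA.
by rewrite scalerDr !scalerA mulrC.
Qed.

(** A separate constant, with scalars in the normed module [R^o], to which a bilinear structure can
    be attached. *)
Definition scale_bilin W : R^o -> W -> W := @GRing.scale R W.

HB.instance Definition _ W :=
  bilinear_isBilinear.Build R R^o W W _ _ (@scale_bilin W) (@scale_is_bilinear W).

Lemma scale_bilin_continuous W :
  continuous (fun p : R^o * W => scale_bilin p.1 p.2).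
Proof.
by move=> p; apply: continuousZ; [exact: cvg_fst|exact: cvg_snd].
Qed.

Lemma is_diff_mulmx V p q r (f df : V -> 'M[R]_(p, q)) (g dg : V -> 'M[R]_(q, r)) x :
  is_diff x f df -> is_diff x g dg ->
  is_diff x (fun y => f y *m g y) (fun v => f x *m dg v + df v *m g x).
Proof. exact: (is_diff_bilin (b := mulmx) (@mulmx_continuous _ _ _ _)). Qed.

Lemma smooth_on_sub V W (U U' : set V) (f : V -> W) :
  U' `<=` U -> smooth_on U f -> smooth_on U' f.
Proof. by move=> UU' fs k; exact: Ck_on_sub (fs k). Qed.

Lemma smooth_on_eq V W (U : set V) (f g : V -> W) :
  open U -> {in U, f =1 g} -> smooth_on U f -> smooth_on U g.
Proof. by move=> Uo fg fs k; exact: Ck_on_eq (fs k). Qed.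

Lemma smooth_on_cst V W (U : set V) (c : W) : open U -> smooth_on U (fun=> c).
Proof. by move=> Uo k; exact: Ck_on_cst. Qed.

Lemma smooth_onD V W (U : set V) (f g : V -> W) : open U ->
  smooth_on U f -> smooth_on U g -> smooth_on U (fun x => f x + g x).
Proof. by move=> Uo fs gs k; exact: Ck_onD. Qed.

Lemma smooth_on_lin V W' W (L : {linear W' -> W}) (U : set V) (f : V -> W') :
  open U -> continuous L -> smooth_on U f -> smooth_on U (fun x => L (f x)).
Proof. by move=> Uo Lc fs k; exact: Ck_on_lin. Qed.

Lemma smooth_onN V W (U : set V) (f : V -> W) : open U ->
  smooth_on U f -> smooth_on U (fun x => - f x).
Proof.
move=> Uo fs; apply: (smooth_on_lin (L := -%R)) => //.
exact: opp_continuous.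
Qed.

Lemma smooth_onB V W (U : set V) (f g : V -> W) : open U ->
  smooth_on U f -> smooth_on U g -> smooth_on U (fun x => f x - g x).
Proof. by move=> Uo fs gs; apply: smooth_onD => //; exact: smooth_onN. Qed.

Lemma smooth_on_mulmx V p q r (U : set V) (f : V -> 'M[R]_(p, q))
    (g : V -> 'M[R]_(q, r)) : open U ->
  smooth_on U f -> smooth_on U g -> smooth_on U (fun x => f x *m g x).
Proof.
move=> Uo fs gs k.
exact: (Ck_on_bilin (b := mulmx) Uo (@mulmx_continuous _ _ _ _) (fs k) (gs k)).
Qed.

Lemma smooth_onZ V W (U : set V) (f : V -> R^o) (g : V -> W) : open U ->
  smooth_on U f -> smooth_on U g -> smooth_on U (fun x => f x *: g x).
Proof.
move=> Uo fs gs k.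
exact: (Ck_on_bilin (b := @scale_bilin W) Uo (@scale_bilin_continuous W) (fs k) (gs k)).
Qed.

Lemma smooth_on_sum V W (I : Type) (r : seq I) (U : set V) (F : I -> V -> W) :
  open U -> (forall i, smooth_on U (F i)) ->
  smooth_on U (fun x => \sum_(i <- r) F i x).
Proof.
move=> Uo Fs; elim: r => [|i r IH].
  rewrite (_ : (fun x => _) = fun=> 0); first exact: smooth_on_cst.
  by apply/funext => x; rewrite big_nil.
rewrite (_ : (fun x => _) = fun x => F i x + \sum_(j <- r) F j x); last first.
  by apply/funext => x; rewrite big_cons.
exact: smooth_onD.
Qed.

Lemma smooth_on_coord V p q (U : set V) (f : V -> 'M[R]_(p, q)) i j : open U ->
  smooth_on U f -> smooth_on U (fun x => f x i j : R^o).
Proof.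
by move=> Uo; apply: (smooth_on_lin (L := mxcoord i j) Uo (@mxcoord_continuous _ _ _ i j)).
Qed.

Lemma smooth_on_diff V W (U : set V) (f : V -> W) v :
  smooth_on U f -> smooth_on U (fun x => 'd f x v).
Proof. by move=> fs k; exact: (fs k.+1).2. Qed.

Lemma smooth_on_differentiable V W (U : set V) (f : V -> W) x :
  smooth_on U f -> U x -> differentiable f x.
Proof. by move=> fs; exact: (fs 1).1. Qed.

Lemma smooth_near_eq V W (x : V) (f g : V -> W) :
  {near x, f =1 g} -> smooth_near x f -> smooth_near x g.
Proof.
move=> fg [U [Uo Ux fs]]; exists (U `&` ([set y | f y = g y])^°); split.
- exact/openI/open_interior.
- by split.
- apply: smooth_on_eq (smooth_on_sub _ fs).
  + exact/openI/open_interior.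
  + by move=> y /[!inE] -[_ /interior_subset].
  + by move=> y [].
Qed.

Lemma smooth_near_bin V W1 W2 W (op : (V -> W1) -> (V -> W2) -> V -> W) x f g :
  (forall U, open U -> smooth_on U f -> smooth_on U g -> smooth_on U (op f g)) ->
  smooth_near x f -> smooth_near x g -> smooth_near x (op f g).
Proof.
move=> H [U [Uo Ux fs]] [U' [U'o U'x gs]]; exists (U `&` U'); split=> //.
  exact: openI.
apply: H; first exact: openI.
  by apply: smooth_on_sub fs => y [].
by apply: smooth_on_sub gs => y [].
Qed.

Lemma smooth_near_cst V W (x : V) (c : W) : smooth_near x (fun=> c).
Proof. by exists setT; split=> //; [exact: openT|exact/smooth_on_cst/openT]. Qed.

Lemma smooth_nearD V W (x : V) (f g : V -> W) :
  smooth_near x f -> smooth_near x g -> smooth_near x (fun y => f y + g y).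
Proof.
by apply: (smooth_near_bin (op := fun f g y => f y + g y)) => U; exact: smooth_onD.
Qed.

Lemma smooth_nearZ V W (x : V) (f : V -> R^o) (g : V -> W) :
  smooth_near x f -> smooth_near x g -> smooth_near x (fun y => f y *: g y).
Proof.
by apply: (smooth_near_bin (op := fun (f : V -> R^o) g y => f y *: g y)) => U; exact: smooth_onZ.
Qed.

Lemma smooth_near_coord V p q x (f : V -> 'M[R]_(p, q)) i j :
  smooth_near x f -> smooth_near x (fun x => f x i j : R^o).
Proof. by move=> [U [Uo Ux fs]]; exists U; split => //; exact: smooth_on_coord. Qed.

Lemma smooth_near_sum V W (I : Type) (r : seq I) x (F : I -> V -> W) :
  (forall i, smooth_near x (F i)) ->
  smooth_near x (fun x => \sum_(i <- r) F i x).
Proof.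
move=> Fs; elim: r => [|i r IH].
  rewrite (_ : (fun x => _) = fun=> 0); first exact: smooth_near_cst.
  by apply/funext => y; rewrite big_nil.
rewrite (_ : (fun x => _) = fun x => F i x + \sum_(j <- r) F j x); last first.
  by apply/funext => y; rewrite big_cons.
exact: smooth_nearD.
Qed.

Lemma smooth_near_differentiable V W x (f : V -> W) :
  smooth_near x f -> differentiable f x.
Proof. by move=> [U [_ Ux fs]]; exact: smooth_on_differentiable fs Ux. Qed.

Lemma smooth_near_mulmx V p q r (x : V) (f : V -> 'M[R]_(p, q)) (g : V -> 'M[R]_(q, r)) :
  smooth_near x f -> smooth_near x g -> smooth_near x (fun y => f y *m g y).
Proof.
apply: (smooth_near_bin (op := fun (f : V -> 'M[R]_(p, q)) (g : V -> 'M[R]_(q, r)) y => f y *m g y)) => U.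
exact: smooth_on_mulmx.
Qed.

Lemma smooth_nearB V W (x : V) (f g : V -> W) :
  smooth_near x f -> smooth_near x g -> smooth_near x (fun y => f y - g y).
Proof.
by apply: (smooth_near_bin (op := fun f g y => f y - g y)) => U; exact: smooth_onB.
Qed.

Lemma smooth_nearN V W (x : V) (f : V -> W) :
  smooth_near x f -> smooth_near x (fun y => - f y).
Proof. by move=> [U [Uo Ux fs]]; exists U; split => //; exact: smooth_onN. Qed.

Lemma smooth_near_pair V W1 W2 (x : V) (f : V -> W1) (g : V -> W2) :
  smooth_near x f -> smooth_near x g -> smooth_near x (fun y => (f y, g y)).
Proof.
apply: (smooth_near_bin (op := fun (f : V -> W1) (g : V -> W2) y => (f y, g y))) => U Uo fs gs k.
exact: Ck_on_pair.
Qed.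

Lemma smooth_near_comp_lin (V' V W : normedModType R) (L : {linear V' -> V})
    (x : V') (f : V -> W) :
  continuous L -> smooth_near (L x) f -> smooth_near x (fun y => f (L y)).
Proof.
move=> Lc [U [Uo Ux fs]]; exists (L @^-1` U); split=> //.
  by apply: open_comp => // y _; exact: Lc.
by move=> k; exact: Ck_on_comp_lin.
Qed.

Lemma smooth_near_proj1 (V1 V2 : normedModType R) W (x : V1 * V2) (f : V1 -> W) :
  smooth_near x.1 f -> smooth_near x (fun y => f y.1).
Proof. by apply: (smooth_near_comp_lin (L := fst)) => y; exact: cvg_fst. Qed.

Lemma smooth_near_snd (V1 V2 : normedModType R) (x : V1 * V2) :
  smooth_near x (fun y => y.2).
Proof.
have oT : open [set: V1 * V2] by exact: openT.
exists setT; split=> // k.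
have sc : continuous (snd : V1 * V2 -> V2) by move=> y; exact: cvg_snd.
exact: (Ck_on_lin (L := snd) oT sc (Ck_on_id k oT)).
Qed.

Lemma is_diff_fst (V1 V2 W : normedModType R) (z : V1 * V2) (f df : V1 -> W) :
  is_diff (z.1) f df ->
  is_diff z (fun y : V1 * V2 => f y.1) (fun y : V1 * V2 => df y.1).
Proof.
move=> fd.
have sc : continuous (fst : V1 * V2 -> V1) by move=> y; exact: cvg_fst.
exact: (is_diff_comp (is_diff_lin (L := fst) z sc) fd).
Qed.

Lemma is_diff_snd (V1 V2 : normedModType R) (z : V1 * V2) :
  is_diff z (fun y : V1 * V2 => y.2) (fun y : V1 * V2 => y.2).
Proof.
have sc : continuous (snd : V1 * V2 -> V2) by move=> y; exact: cvg_snd.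
exact: (is_diff_lin (L := snd) z sc).
Qed.

Lemma dir_diff_fst (V W1 W2 : normedModType R) (F : V -> W1 * W2) x v :
  differentiable F x -> (dir_diff F x v).1 = dir_diff (fun y => (F y).1) x v.
Proof.
move=> Fd; apply/esym.
have sc : continuous (fst : W1 * W2 -> W1) by move=> y; exact: cvg_fst.
exact: dir_diff_val (is_diff_linl (L := fst) sc (is_diff_dir_diff Fd)).
Qed.

Lemma is_diff_comp_snd (V W1 W2 : normedModType R) (F dF : V -> W1 * W2) x :
  is_diff x F dF -> is_diff x (fun y => (F y).2) (fun y => (dF y).2).
Proof.
move=> Fd.
have sc : continuous (snd : W1 * W2 -> W2) by move=> y; exact: cvg_snd.
exact: (is_diff_linl (L := snd) sc Fd).
Qed.

End smooth_closure.

(** * Charts and Christoffel matrices *)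

Section charts.
Context {R : realType} {n : nat} (M : manifold R n).
Implicit Types (a b c : midx M) (x z : M).

Local Notation dom a := (cdom (mchart a)).
Local Notation bwd a := (cbwd (mchart a)).

Definition overlap a b : set 'cV[R]_n := crd a @` (dom a `&` dom b).

Lemma bwd_crd a x : dom a x -> bwd a (crd a x) = x.
Proof. exact: cfwdK. Qed.

Lemma trans_crd a b x : dom a x -> trans a b (crd a x) = crd b x.
Proof. by move=> ax; rewrite /trans /= bwd_crd. Qed.

(** [cbwd] is total but meaningful only on the chart image. That image is open and [cbwd] is
    continuous on it, so neighbourhoods pass from M to coordinates. *)
Lemma near_chart a x (P : set M) : dom a x -> nbhs x P ->
  \forall y \near crd a x, exists z, [/\ dom a z, P z & y = crd a z].
Proof.
move=> ax Px; have ix : (crd a @` dom a) (crd a x) by exists x.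
have bc := cbwd_cont ix.
have bP : nbhs (bwd a (crd a x)) P by rewrite bwd_crd.
have : nbhs (crd a x) (crd a @` dom a `&` bwd a @^-1` P).
  by apply: filterI; [apply: open_nbhs_nbhs; split=> //; exact: cimg_open|exact: bc].
apply: filterS => y [[z az <-]]; rewrite /preimage /= bwd_crd // => Pz.
by exists z.
Qed.

Lemma near_dom a x : dom a x -> nbhs x (dom a).
Proof. by move=> ax; apply: open_nbhs_nbhs; split=> //; exact: cdom_open. Qed.

Lemma overlap_open a b : open (overlap a b).
Proof.
rewrite openE => _ [x [ax bx] <-].
by apply: filterS (near_chart ax (near_dom bx)) => _ [z [az bz ->]]; exists z.
Qed.

Lemma overlap_crd a b x : dom a x -> dom b x -> overlap a b (crd a x).
Proof. by move=> ax bx; exists x. Qed.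

Lemma trans_smooth a b : smooth_on (overlap a b) (trans a b).
Proof. exact: mcompat. Qed.

Lemma trans_diff a b x : dom a x -> dom b x ->
  is_diff (crd a x) (trans a b) (mulmx (dtrans a b (crd a x))).
Proof.
move=> ax bx.
have td : differentiable (trans a b) (crd a x).
  exact: smooth_on_differentiable (trans_smooth a b) (overlap_crd ax bx).
apply: is_diffW (differentiableP td) => v.
rewrite {1}[v]matrix_sum_delta linear_sum.
apply/colP => i; rewrite summxE !mxE; apply: eq_bigr => k _.
by rewrite big_ord1 linearZ !mxE mulrC.
Qed.

Lemma dtransE a b x v : dom a x -> dom b x ->
  'd (trans a b) (crd a x) v = dtrans a b (crd a x) *m v.
Proof. by move=> ax bx; have [_ ->] := trans_diff ax bx. Qed.

Lemma mulmx_inj p q (A B : 'M[R]_(p, q)) :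
  (forall v : 'cV_q, A *m v = B *m v) -> A = B.
Proof.
move=> AB; apply/matrixP => i j; have /colP/(_ i) := AB (delta_mx j 0).
by rewrite -!colE !mxE.
Qed.

(** Chain rule: [trans b c] after [trans a b] agrees with [trans a c] near [crd a x]. *)
Lemma dtrans_comp a b c x : dom a x -> dom b x -> dom c x ->
  dtrans b c (crd b x) *m dtrans a b (crd a x) = dtrans a c (crd a x).
Proof.
move=> ax bx cx.
have d2 : is_diff (trans a b (crd a x)) (trans b c) (mulmx (dtrans b c (crd b x))).
  by rewrite trans_crd //; exact: trans_diff.
have d12 := is_diff_comp (trans_diff ax bx) d2.
apply: mulmx_inj => v; rewrite -mulmxA.
apply: (is_diff_inj (is_diff_near_eq _ d12) (trans_diff ax cx)).
have := near_chart ax (near_dom bx).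
by apply: filterS => _ [z [az bz ->]]; rewrite /= !trans_crd.
Qed.

Lemma dtrans_id a x : dom a x -> dtrans a a (crd a x) = 1%:M.
Proof.
move=> ax; apply: mulmx_inj => v; rewrite mul1mx.
apply: (is_diff_inj (is_diff_near_eq _ (trans_diff ax ax)) (is_diff_id (crd a x))).
have := near_chart ax (near_dom ax).
by apply: filterS => _ [z [az _ ->]]; rewrite /= !trans_crd.
Qed.

Lemma dtransK a b x : dom a x -> dom b x ->
  dtrans b a (crd b x) *m dtrans a b (crd a x) = 1%:M.
Proof. by move=> ax bx; rewrite dtrans_comp // dtrans_id. Qed.

Lemma dtrans_smooth a b : smooth_on (overlap a b) (dtrans a b).
Proof.
have oo := @overlap_open a b.
apply: (@smooth_on_eq _ _ _ _
  (fun y => \sum_(k < n) 'd (trans a b) y (delta_mx k 0) *m (delta_mx 0 k : 'rV_n))) => //.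
  move=> y _; apply/matrixP => i j; rewrite summxE (bigD1 j) //= big1 ?addr0.
    by rewrite !mxE big_ord1 !mxE !eqxx mulr1.
  by move=> k kj; rewrite !mxE big_ord1 !mxE (eq_sym j) (negbTE kj) andbF mulr0.
apply: smooth_on_sum => // k; apply: smooth_on_mulmx => //.
  exact/smooth_on_diff/trans_smooth.
exact: smooth_on_cst.
Qed.

(* The inverse Jacobian of [trans b a], as a function on the chart b. *)
Definition dtransV b a (y : 'cV[R]_n) : 'M[R]_n := dtrans a b (trans b a y).

Lemma dtransV_crd b a x : dom b x -> dtransV b a (crd b x) = dtrans a b (crd a x).
Proof. by move=> bx; rewrite /dtransV trans_crd. Qed.

(** The matrix is the pointwise inverse of the smooth [dtrans b a], so [smooth_on_mxinv] applies;
    composition of maps only serves to get first-order differentiability. *)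
Lemma dtransV_smooth b a : smooth_on (overlap b a) (dtransV b a).
Proof.
have oo := @overlap_open b a.
apply: (smooth_on_mxinv (A := dtrans b a)) => //; last exact: dtrans_smooth.
  move=> _ [x [bx ax] <-].
  apply: (@differentiable_comp _ _ _ _ (trans b a) (dtrans a b)).
    by have [] := trans_diff bx ax.
  rewrite trans_crd //.
  exact: smooth_on_differentiable (dtrans_smooth a b) (overlap_crd ax bx).
by move=> _ [x [bx ax] <-]; rewrite dtransV_crd // dtransK.
Qed.

Lemma tcomp_pref x v : tcomp (pref x) x v = v.
Proof. by rewrite /tcomp dtrans_id ?mul1mx //; exact: prefP. Qed.

Lemma frame_pref i x : frame (pref x) i x = delta_mx i 0.
Proof. by rewrite /frame dtrans_id ?mul1mx //; exact: prefP. Qed.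

Lemma tcomp_frame a b i x : dom a x -> dom b x ->
  tcomp b x (frame a i x) = dtrans a b (crd a x) *m delta_mx i 0.
Proof.
move=> ax bx.
by rewrite /tcomp /frame /pcrd [LHS]mulmxA (dtrans_comp ax (prefP x) bx).
Qed.

Lemma frame_decomp a x v : dom a x ->
  v = \sum_i tcomp a x v i 0 *: frame a i x.
Proof.
move=> ax; have px := prefP x.
have -> : \sum_i tcomp a x v i 0 *: frame a i x =
    dtrans a (pref x) (crd a x) *m tcomp a x v.
  rewrite [in RHS](matrix_sum_delta (tcomp a x v)) mulmx_sumr.
  by apply: eq_bigr => i _; rewrite big_ord1 -scalemxAr.
by rewrite /tcomp mulmxA /pcrd (dtransK px ax) mul1mx.
Qed.

Lemma vf_loc_crd x (Y : vfield M) z : dom (pref x) z ->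
  vf_loc x Y (crd (pref x) z) = tcomp (pref x) z (Y z).
Proof. by move=> xz; rewrite /vf_loc /fun_loc /= bwd_crd. Qed.

Lemma fun_loc_crd W x (f : M -> W) z : dom (pref x) z ->
  fun_loc x f (crd (pref x) z) = f z.
Proof. by move=> xz; rewrite /fun_loc /= bwd_crd. Qed.

Lemma near_loc x (P : 'cV[R]_n -> Prop) (Q : set M) : nbhs x Q ->
  (forall z, dom (pref x) z -> Q z -> P (crd (pref x) z)) ->
  \forall y \near pcrd x, P y.
Proof.
move=> Qx QP; have := near_chart (prefP x) Qx.
by apply: filterS => _ [z [xz Qz ->]]; exact: QP.
Qed.

Lemma fun_smooth_near_eq x (f g : M -> R) : {near x, f =1 g} ->
  fun_smooth_at x f -> fun_smooth_at x g.
Proof.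
move=> fg; apply: smooth_near_eq; apply: (near_loc fg) => z xz /= fgz.
by rewrite !fun_loc_crd.
Qed.

Lemma vf_smooth_near_eq x (Y Z : vfield M) : {near x, Y =1 Z} ->
  vf_smooth_at x Y -> vf_smooth_at x Z.
Proof.
move=> YZ; apply: smooth_near_eq; apply: (near_loc YZ) => z xz /= YZz.
by rewrite !vf_loc_crd // YZz.
Qed.

Lemma vf_loc_frame a i x : dom a x ->
  {near pcrd x, vf_loc x (frame a i) =1
     fun y => dtransV (pref x) a y *m delta_mx i 0}.
Proof.
move=> ax; apply: (near_loc (near_dom ax)) => z xz az.
by rewrite (vf_loc_crd _ xz) (tcomp_frame i az xz) (dtransV_crd a xz).
Qed.

Lemma frame_smooth a i x : dom a x -> vf_smooth_at x (frame a i).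
Proof.
move=> ax; have oo := @overlap_open (pref x) a.
apply: (@smooth_near_eq _ _ _ _ (fun y => dtransV (pref x) a y *m delta_mx i 0)).
  by apply: filterS (vf_loc_frame i ax) => y ->.
exists (overlap (pref x) a); split=> //; first exact/overlap_crd/ax/prefP.
apply: smooth_on_mulmx => //; first exact: dtransV_smooth.
exact: smooth_on_cst.
Qed.

Lemma vf_smoothD x (Y Z : vfield M) : vf_smooth_at x Y -> vf_smooth_at x Z ->
  vf_smooth_at x (fun y => Y y + Z y).
Proof.
move=> Ys Zs; apply: smooth_near_eq (smooth_nearD Ys Zs).
by apply: filterE => y; rewrite /vf_loc /fun_loc /= /tcomp mulmxDr.
Qed.

Lemma vf_smoothZ x (f : M -> R) (Y : vfield M) :
  fun_smooth_at x f -> vf_smooth_at x Y -> vf_smooth_at x (fun y => f y *: Y y).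
Proof.
move=> fs Ys; apply: smooth_near_eq (smooth_nearZ fs Ys).
by apply: filterE => y; rewrite /vf_loc /fun_loc /= /tcomp scalemxAr.
Qed.

Lemma vf_smooth0 x : vf_smooth_at x (fun=> 0).
Proof.
apply: smooth_near_eq (smooth_near_cst _ 0).
by apply: filterE => y; rewrite /vf_loc /fun_loc /= /tcomp mulmx0.
Qed.

Lemma vf_smooth_sum x (I : Type) (r : seq I) (F : I -> vfield M) :
  (forall i, vf_smooth_at x (F i)) ->
  vf_smooth_at x (fun y => \sum_(i <- r) F i y).
Proof.
move=> Fs; elim: r => [|i r IH].
  by apply: vf_smooth_near_eq (vf_smooth0 x); apply: filterE => y; rewrite big_nil.
apply: vf_smooth_near_eq (vf_smoothD (Fs i) IH).
by apply: filterE => y; rewrite big_cons.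
Qed.

Lemma fun_smooth_cst x (c : R) : fun_smooth_at x (fun=> c).
Proof. exact: smooth_near_cst. Qed.

Lemma vf_smooth_comp x (Y : vfield M) i :
  vf_smooth_at x Y -> fun_smooth_at x (fun z => tcomp (pref x) z (Y z) i 0).
Proof. by move=> Ys; exact: smooth_near_coord Ys. Qed.

Lemma dfun_comp x (Y : vfield M) i w : vf_smooth_at x Y ->
  dfun x w (fun z => tcomp (pref x) z (Y z) i 0) = 'd (vf_loc x Y) (pcrd x) w i 0.
Proof.
move=> Ys; rewrite /dfun.
have := diff_mxcoord i 0 w (smooth_near_differentiable Ys).
by [].
Qed.

End charts.

(** * Covariant derivatives in coordinates *)

Section christoffel.
Context {R : realType} {n : nat} (M : manifold R n) (D : connection M).
Implicit Types (a b c : midx M) (x z : M).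

Local Notation dom a := (cdom (mchart a)).
Local Notation bwd a := (cbwd (mchart a)).

(* The Leibniz rule for the indicator function of a neighbourhood on which
   the two fields agree. *)
Lemma cov_near_eq x w (Y Z : vfield M) : {near x, Y =1 Z} ->
  vf_smooth_at x Y -> cov D x w Y = cov D x w Z.
Proof.
move=> YZ Ys; have Zs := vf_smooth_near_eq YZ Ys.
pose f z : R := if `[< Y z = Z z >] then 1 else 0.
have f1 : {near x, cst 1 =1 f}.
  by apply: filterS YZ => z YZz; rewrite /f asboolT.
have fs : fun_smooth_at x f by exact: fun_smooth_near_eq f1 (fun_smooth_cst _ _).
have df : dfun x w f = 0.
  rewrite /dfun.
  have d1 : is_diff (pcrd x) (fun_loc x f : _ -> R^o) 0.
    apply: (@is_diff_near_eq R _ R^o (cst 1)) => //.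
    by apply: (near_loc f1) => z xz /= fz; rewrite fun_loc_crd.
  by have [_ ->] := d1.
have fx : f x = 1 by rewrite -(nbhs_singleton f1).
have H V : vf_smooth_at x V -> cov D x w V = cov D x w (fun y => f y *: V y).
  by move=> Vs; rewrite cov_leibniz // df fx scale0r add0r scale1r.
rewrite H // [RHS]H //; congr cov; apply/funext => y; rewrite /f.
by case: asboolP => [->//|_]; rewrite !scale0r.
Qed.

Lemma cov0 x w : cov D x w (fun=> 0) = 0.
Proof.
have := cov_leibniz D w (fun_smooth_cst x 0) (vf_smooth0 x).
by rewrite !scale0r scaler0 addr0.
Qed.

Lemma cov_sum x w (I : Type) (r : seq I) (F : I -> vfield M) :
  (forall i, vf_smooth_at x (F i)) ->
  cov D x w (fun y => \sum_(i <- r) F i y) = \sum_(i <- r) cov D x w (F i).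
Proof.
move=> Fs; elim: r => [|i r IH].
  by rewrite big_nil -[RHS](cov0 x w); congr cov; apply/funext => y; rewrite big_nil.
rewrite big_cons -IH -cov_add //; last exact: vf_smooth_sum.
by congr cov; apply/funext => y; rewrite big_cons.
Qed.

(** The connection form of [D] in the coordinate frame of [pref x], evaluated on [w]. *)
Definition christoffel x (w : 'cV[R]_n) : 'M[R]_n :=
  \matrix_(k, i) cov D x w (frame (pref x) i) k 0.

Lemma christoffelE x w (v : 'cV[R]_n) :
  christoffel x w *m v = \sum_i v i 0 *: cov D x w (frame (pref x) i).
Proof.
apply/colP => k; rewrite summxE mxE; apply: eq_bigr => i _.
by rewrite !mxE mulrC.
Qed.

Lemma christoffelP x (c : R) u v :
  christoffel x (c *: u + v) = c *: christoffel x u + christoffel x v.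
Proof.
apply/matrixP => k i; rewrite !mxE cov_linear ?mxE //.
exact/frame_smooth/prefP.
Qed.

(** Expand [Y] in the coordinate frame and apply the Leibniz rule to each term. The expansion holds
    only on the chart domain, whence [cov_near_eq]. *)
Lemma covE x w (Y : vfield M) : vf_smooth_at x Y ->
  cov D x w Y = 'd (vf_loc x Y) (pcrd x) w + christoffel x w *m Y x.
Proof.
move=> Ys; pose F i : vfield M := fun z => tcomp (pref x) z (Y z) i 0 *: frame (pref x) i z.
have fs i := frame_smooth i (prefP x).
have Fs i : vf_smooth_at x (F i) by exact: vf_smoothZ (vf_smooth_comp i Ys) (fs i).
rewrite (@cov_near_eq x w Y (fun z => \sum_i F i z)) //; last first.
  apply: filterS (near_dom (prefP x)) => z xz; exact: frame_decomp.
rewrite cov_sum // christoffelE.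
have -> : 'd (vf_loc x Y) (pcrd x) w =
    \sum_i 'd (vf_loc x Y) (pcrd x) w i 0 *: delta_mx i 0.
  by rewrite {1}[LHS]matrix_sum_delta; apply: eq_bigr => i _; rewrite big_ord1.
rewrite -big_split /=; apply: eq_bigr => i _.
rewrite /F cov_leibniz //; last exact: vf_smooth_comp.
by rewrite dfun_comp // frame_pref tcomp_pref.
Qed.

(* Christoffel matrix at x in the chart a, the direction w being given in the
   chart [pref x]. *)
Definition chart_christoffel a x (w : 'cV[R]_n) : 'M[R]_n :=
  \matrix_(k, i) tcomp a x (cov D x w (frame a i)) k 0.

(** In the chart [pref x] the frame of [a] consists of the columns of [dtransV (pref x) a]; [covE]
    differentiates them, and the outer factor converts the result back to the chart [a]. *)
Lemma chart_christoffelE a x w : dom a x ->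
  chart_christoffel a x w = dtrans (pref x) a (pcrd x) *m
    (dir_diff (dtransV (pref x) a) (pcrd x) w +
     christoffel x w *m dtransV (pref x) a (pcrd x)).
Proof.
move=> ax; have px := prefP x.
have dV : differentiable (dtransV (pref x) a) (pcrd x).
  exact: smooth_on_differentiable (@dtransV_smooth _ _ _ _ _) (overlap_crd px ax).
apply: mulmx_inj => v; rewrite -mulmxA.
suff H i : chart_christoffel a x w *m delta_mx i 0 =
   dtrans (pref x) a (pcrd x) *m ((dir_diff (dtransV (pref x) a) (pcrd x) w +
     christoffel x w *m dtransV (pref x) a (pcrd x)) *m (delta_mx i 0 : 'cV_n)).
  rewrite [v]matrix_sum_delta !mulmx_sumr; apply: eq_bigr => i _.
  by rewrite big_ord1 -!scalemxAr H.
have -> : chart_christoffel a x w *m (delta_mx i 0 : 'cV_n) = tcomp a x (cov D x w (frame a i)).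
  by rewrite -colE; apply/colP => k; rewrite !mxE.
rewrite /tcomp (covE w (frame_smooth i ax)); congr (_ *m _).
rewrite [RHS]mulmxDl; congr (_ + _); last first.
  rewrite /frame /pcrd (dtransV_crd a px).
  exact: mulmxA.
have d1 : is_diff (pcrd x) (fun y => dtransV (pref x) a y *m delta_mx i 0 : 'cV_n)
    (fun v => dir_diff (dtransV (pref x) a) (pcrd x) v *m delta_mx i 0).
  apply: is_diffW (is_diff_mulmx (is_diff_dir_diff dV)
    (is_diff_cst (delta_mx i 0 : 'cV_n) _)).
  by move=> u /=; rewrite mulmx0 add0r.
have eqd : {near pcrd x, (fun y => dtransV (pref x) a y *m delta_mx i 0 : 'cV_n) =1
    vf_loc x (frame a i)}.
  by apply: filterS (vf_loc_frame i ax) => y ->.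
by have [_ ->] := is_diff_near_eq eqd d1.
Qed.

End christoffel.

(** * The torsion identity for all complex structures *)

(** The trace of the endomorphism v |-> T(u, v). *)
Definition torsion_trace (R : pzRingType) (n : nat)
    (T : 'cV[R]_n -> 'cV[R]_n -> 'cV[R]_n) (u : 'cV[R]_n) : R :=
  \sum_i T u (delta_mx i 0) i 0.

Section torsion_algebra.
Context {R : realFieldType} {m : nat}.
Local Notation n := (2 * m)%N.
Implicit Types a b c d i k : 'I_n.

Lemma half_turn_subproof i : ((if i < m then i + m else i - m) < n)%N.
Proof. by have := ltn_ord i; case: ifP; lia. Qed.

(** A fixed-point-free involution of the indices, which exists because n = 2m is even; the pairings
    below are conjugates of it. *)
Definition half_turn i : 'I_n := Ordinal (half_turn_subproof i).

Lemma half_turnK : involutive half_turn.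
Proof.
move=> i; apply: val_inj => /=; have := ltn_ord i.
by case: (ltnP i m) => im; case: ifP; lia.
Qed.

Lemma half_turn_neq i : half_turn i != i.
Proof. by apply/eqP => /(congr1 val) /=; have := ltn_ord i; case: ifP; lia. Qed.

(** Conjugation by a transposition keeps an involution free of fixed points. Conjugating [half_turn]
    by the swap of [half_turn a] and [c] gives [t1] with a -> c; conjugating [t1] by the swap of
    [t1 b] and [d] gives b -> d, and keeps a -> c because this swap fixes a and c. *)
Lemma ex_pairing a b c d : uniq [:: a; b; c; d] ->
  exists tau : 'I_n -> 'I_n,
    [/\ involutive tau, forall i, tau i != i, tau a = c & tau b = d].
Proof.
rewrite /= !inE !negb_or => /and4P[/and3P[ab ac ad] /andP[bc bd] cd _].
have conj (tau : 'I_n -> 'I_n) (p : {perm 'I_n}) :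
    involutive tau -> (forall i, tau i != i) -> involutive p ->
    involutive (p \o tau \o p) /\ forall i, (p \o tau \o p) i != i.
  move=> tauK taun pK; split=> i /=; first by rewrite pK tauK pK.
  by rewrite -{2}[i]pK (inj_eq perm_inj).
pose p := tperm (half_turn a) c.
have pK : involutive p by move=> i; rewrite /p tpermK.
have [t1K t1n] := conj _ p half_turnK half_turn_neq pK.
set t1 := p \o half_turn \o p in t1K t1n.
have pa : p a = a by rewrite /p tpermD ?half_turn_neq // eq_sym.
have t1a : t1 a = c by rewrite /t1 /= pa /p tpermL.
have t1c : t1 c = a by rewrite -t1a t1K.
pose q := tperm (t1 b) d.
have qK : involutive q by move=> i; rewrite /q tpermK.
have [t2K t2n] := conj _ q t1K t1n qK.
have t1ba : t1 b != a by rewrite -t1c (inj_eq (can_inj t1K)).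
have t1bc : t1 b != c by rewrite -t1a (inj_eq (can_inj t1K)) eq_sym.
exists (q \o t1 \o q); split=> //=.
- have -> : q a = a by rewrite /q tpermD // eq_sym.
  by rewrite t1a /q tpermD // eq_sym.
- have -> : q b = b by rewrite /q tpermD // eq_sym.
  by rewrite /q tpermL.
Qed.

Section pairing_matrix.
Variables (tau : 'I_n -> 'I_n) (e : 'I_n -> R).
Hypotheses (tauK : involutive tau) (eN : forall i, e i * e (tau i) = -1).

Definition pairing_mx : 'M[R]_n := \matrix_(i, k) (if i == tau k then e k else 0).

Lemma pairing_mxE (w : 'cV[R]_n) i : (pairing_mx *m w) i 0 = e (tau i) * w (tau i) 0.
Proof.
rewrite mxE (bigD1 (tau i)) //= big1 ?addr0 => [|k ki].
  by rewrite mxE tauK eqxx.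
by rewrite mxE -(inj_eq (can_inj tauK)) tauK eq_sym (negbTE ki) mul0r.
Qed.

Lemma pairing_mx_delta k :
  pairing_mx *m (delta_mx k 0 : 'cV_n) = e k *: delta_mx (tau k) 0.
Proof.
apply/colP => i; rewrite pairing_mxE !mxE eqxx !andbT.
rewrite -(inj_eq (can_inj tauK)) tauK.
by case: eqP => [->|_]; rewrite ?tauK ?mulr1 ?mulr0.
Qed.

(** The square multiplies the k-th basis vector by [e k * e (tau k)]. *)
Lemma pairing_mx_sqr : pairing_mx *m pairing_mx = - 1%:M.
Proof.
apply/matrixP => i k.
have -> : (pairing_mx *m pairing_mx) i k =
    (pairing_mx *m (pairing_mx *m (delta_mx k 0 : 'cV_n))) i 0.
  by rewrite mulmxA -colE [RHS]mxE.
rewrite pairing_mx_delta -scalemxAr pairing_mx_delta tauK scalerA eN !mxE eqxx.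
by rewrite andbT; case: eqP => _; rewrite ?mulr1 ?mulr0 ?mulr1n ?mulr0n ?oppr0.
Qed.
End pairing_matrix.

Variable T : 'cV[R]_n -> 'cV[R]_n -> 'cV[R]_n.
Hypothesis Tl : forall (x : R) u v w, T (x *: u + v) w = x *: T u w + T v w.
Hypothesis Talt : forall u v, T u v = - T v u.
Hypothesis TJ : forall j : 'M[R]_n, j *m j = - 1%:M -> forall u v,
  T u v - T (j *m u) (j *m v) + j *m T (j *m u) v + j *m T u (j *m v) = 0.

Local Notation E i := (delta_mx i 0 : 'cV[R]_n).
Local Notation t a b c := (T (E a) (E b) c 0).

Let T0l w : T 0 w = 0.
Proof. by have := Tl (-1) 0 0 w; rewrite scaler0 addr0 scaleN1r addNr. Qed.

Let TZl (x : R) u w : T (x *: u) w = x *: T u w.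
Proof. by have := Tl x u 0 w; rewrite T0l !addr0. Qed.

Let TDl u v w : T (u + v) w = T u w + T v w.
Proof. by have := Tl 1 u v w; rewrite !scale1r. Qed.

Let TZr (x : R) u w : T u (x *: w) = x *: T u w.
Proof. by rewrite Talt TZl -scalerN -Talt. Qed.

Let Tsuml (I : Type) (r : seq I) (F : I -> 'cV_n) w :
  T (\sum_(i <- r) F i) w = \sum_(i <- r) T (F i) w.
Proof.
elim: r => [|i r IH]; first by rewrite !big_nil T0l.
by rewrite !big_cons TDl IH.
Qed.

Let Tsumr (I : Type) (r : seq I) (F : I -> 'cV_n) w :
  T w (\sum_(i <- r) F i) = \sum_(i <- r) T w (F i).
Proof.
by rewrite Talt Tsuml -sumrN; apply: eq_bigr => i _; rewrite -Talt.
Qed.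

(** This is the c-component of [TJ] at (e_a, e_b), for a complex structure J with J e_a = s e_c and
    J e_b = r e_d. The c-component of J w is s times the a-component of w, which accounts for the
    second factor s in the last two products. *)
Lemma torsion_coef_rel a b c d (s r : R) : uniq [:: a; b; c; d] ->
  s != 0 -> r != 0 ->
  t a b c + s * r * (t a d a - t c d c) + s ^+ 2 * t c b a = 0.
Proof.
move=> abcd s0 r0; have [tau [tauK taun taua taub]] := ex_pairing abcd.
move: abcd; rewrite /= !inE !negb_or => /and4P[/and3P[ab ac ad] /andP[bc bd] cd _].
(* On {a, b, c, d} the values are forced by s, r and [eN]. Every other pair {i, tau i} gets 1 at its
   smaller index and -1 at its larger one. *)
pose e i : R := if i == a then s else if i == c then - s^-1 else
  if i == b then r else if i == d then - r^-1 else
  if (i < tau i)%N then 1 else -1.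
have tauc : tau c = a by rewrite -taua tauK.
have taud : tau d = b by rewrite -taub tauK.
have ea : e a = s by rewrite /e eqxx.
have ec : e c = - s^-1 by rewrite /e eqxx eq_sym (negbTE ac).
have eb : e b = r by rewrite /e eqxx eq_sym (negbTE ab) (negbTE bc).
have ed : e d = - r^-1.
  by rewrite /e eqxx ![d == _]eq_sym (negbTE ad) (negbTE bd) (negbTE cd).
have eN i : e i * e (tau i) = -1.
  have [->|ia] := eqVneq i a; first by rewrite taua ea ec mulrN mulfV.
  have [->|ic] := eqVneq i c; first by rewrite tauc ea ec mulNr mulVf.
  have [->|ib] := eqVneq i b; first by rewrite taub eb ed mulrN mulfV.
  have [->|id] := eqVneq i d; first by rewrite taud eb ed mulNr mulVf.
  have ta : tau i != a by rewrite -tauc (inj_eq (can_inj tauK)).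
  have tc : tau i != c by rewrite -taua (inj_eq (can_inj tauK)).
  have tb : tau i != b by rewrite -taud (inj_eq (can_inj tauK)).
  have td : tau i != d by rewrite -taub (inj_eq (can_inj tauK)).
  rewrite /e (negbTE ia) (negbTE ic) (negbTE ib) (negbTE id).
  rewrite (negbTE ta) (negbTE tc) (negbTE tb) (negbTE td) tauK.
  have := taun i; rewrite -val_eqE neq_ltn.
  by case: (ltngtP (tau i) i) => //= _ _; rewrite ?mulrN ?mulNr mulr1.
have /(congr1 (fun w : 'cV_n => w c 0)) := TJ (pairing_mx_sqr tauK eN) (E a) (E b).
rewrite !pairing_mx_delta // !TZl !TZr taua taub.
have addE (A B : 'cV[R]_n) : (A + B) c 0 = A c 0 + B c 0 by rewrite mxE.
rewrite !addE !pairing_mxE // tauc ea eb.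
rewrite !mxE => H; rewrite -[RHS]H; ring.
Qed.

Let tN a b c : t a b c = - t b a c.
Proof. by rewrite Talt mxE. Qed.

(** Three distinct indices give 2m >= 3, and parity leaves room for a fourth. *)
Let ex_fourth a b c : uniq [:: a; b; c] -> exists d, uniq [:: a; b; c; d].
Proof.
move=> abc; have /card_uniqP := abc.
have : (3 <= #|'I_n|)%N by move/card_uniqP: abc => /= <-; exact: max_card.
rewrite card_ord => n3 c3.
have cS : #|[set x in [:: a; b; c]]| = 3 by rewrite cardsE c3.
have /card_gt0P [d] : (0 < #|~: [set x in [:: a; b; c]]|)%N.
  by have := cardsC [set x in [:: a; b; c]]; rewrite card_ord cS; lia.
rewrite !inE !negb_or => /and3P[da db dc]; exists d.
move: abc; rewrite /= !inE !negb_or => /and3P[/andP[-> ->] -> _].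
by rewrite ![_ == d]eq_sym da db dc.
Qed.

(** Comparing (s, r) = (1, 1) with (1, -1) kills the middle term. What remains is t + t' = 0 for s =
    1 and t + 4 t' = 0 for s = 2, with t = [t a b c] and t' = [t c b a]. *)
Lemma torsion_coef_eq0 a b c d : uniq [:: a; b; c; d] ->
  t a b c = 0 /\ t a d a = t c d c.
Proof.
move=> abcd.
have H1 := torsion_coef_rel abcd (oner_neq0 R) (oner_neq0 R).
have N1 : (-1 : R) != 0 by rewrite oppr_eq0 oner_neq0.
have N2 : (2 : R) != 0 by rewrite pnatr_eq0.
have H2 := torsion_coef_rel abcd (oner_neq0 R) N1.
have H3 := torsion_coef_rel abcd N2 (oner_neq0 R).
by split; lra.
Qed.

(** By the second relation of [torsion_coef_eq0], [t a i i] is the same for all i different from a,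
    and [t a a a] vanishes by alternation. A fourth index is called for only if some i differs from
    both a and b. *)
Let torsion_traceE a b : a != b -> torsion_trace T (E a) = (n%:R - 1) * t a b b.
Proof.
move=> ab; rewrite /torsion_trace (bigD1 a) //=.
have -> : t a a a = 0 by have := tN a a a; lra.
rewrite add0r (eq_bigr (fun=> t a b b)).
  have n0 : (0 < n)%N by exact: leq_ltn_trans (leq0n a) (ltn_ord a).
  have -> : n%:R - 1 = n.-1%:R :> R by rewrite -subn1 natrB.
  rewrite sumr_const (_ : #|_| = n.-1) ?mulr_natl //.
  by rewrite (cardC1 a) card_ord.
move=> i ia; have [->//|ib] := eqVneq i b.
have abi : uniq [:: i; a; b] by rewrite /= !inE negb_or ia ib ab.
have [d abid] := ex_fourth abi.
have iabd : uniq [:: i; d; b; a].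
  by move: abid; rewrite /= !inE !negb_or ![_ == d]eq_sym ![_ == a]eq_sym
     => /and4P[/and3P[-> -> ->] /andP[-> ->] -> _].
by rewrite (tN a i) (torsion_coef_eq0 iabd).2 -tN.
Qed.

(** On basis vectors e_a, e_b the components at a and b are traces by [torsion_traceE], and the
    others vanish by [torsion_coef_eq0]. Bilinearity does the rest. *)
Lemma torsion_trace_form u v :
  (n%:R - 1) *: T u v = torsion_trace T u *: v - torsion_trace T v *: u.
Proof.
have base a b : (n%:R - 1) *: T (E a) (E b) =
    torsion_trace T (E a) *: E b - torsion_trace T (E b) *: E a.
  have [->|ab] := eqVneq a b.
    rewrite subrr (_ : T _ _ = 0) ?scaler0 //.
    by apply/colP => i; rewrite mxE; have := tN b b i; lra.
  apply/colP => c; rewrite !mxE eqxx !andbT.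
  have [->|cb] := eqVneq c b.
    by rewrite eq_sym (negbTE ab) (torsion_traceE ab) /=; ring.
  have [->|ca] := eqVneq c a.
    by rewrite (@torsion_traceE b a) 1?eq_sym // (tN a b) /=; ring.
  have abc : uniq [:: a; b; c] by rewrite /= !inE negb_or ab ![_ == c]eq_sym ca cb.
  have [d abcd] := ex_fourth abc.
  by rewrite (torsion_coef_eq0 abcd).1 !mulr0 subrr.
have tr_sum w : torsion_trace T w = \sum_a w a 0 * torsion_trace T (E a).
  rewrite /torsion_trace; under [RHS]eq_bigr do rewrite mulr_sumr.
  rewrite exchange_big /=; apply: eq_bigr => i _.
  rewrite {1}[w]matrix_sum_delta Tsuml summxE; apply: eq_bigr => a _.
  by rewrite big_ord1 TZl mxE.
have colE_sum (w : 'cV[R]_n) : w = \sum_a w a 0 *: E a.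
  by rewrite {1}[w]matrix_sum_delta; apply: eq_bigr => a _; rewrite big_ord1.
have TE : T u v = \sum_a \sum_b (u a 0 * v b 0) *: T (E a) (E b).
  rewrite {1}(colE_sum u) Tsuml; apply: eq_bigr => a _.
  rewrite {1}(colE_sum v) Tsumr; apply: eq_bigr => b _.
  by rewrite TZl TZr scalerA.
have trE (w w' : 'cV[R]_n) : torsion_trace T w *: w' =
    \sum_a \sum_b (w a 0 * w' b 0) *: (torsion_trace T (E a) *: E b).
  rewrite tr_sum scaler_suml; apply: eq_bigr => a _.
  rewrite {1}(colE_sum w') scaler_sumr; apply: eq_bigr => b _.
  by rewrite !scalerA mulrAC.
rewrite TE !trE [X in _ = _ - X]exchange_big -sumrB scaler_sumr; apply: eq_bigr => a _.
rewrite -sumrB scaler_sumr; apply: eq_bigr => b _.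
rewrite [v b 0 * _]mulrC -scalerBr -base !scalerA; congr (_ *: _).
exact: mulrC.
Qed.

End torsion_algebra.

(** * Torsion and change of connection *)

Section torsion_tensor.
Context {R : realType} {n : nat} (M : manifold R n) (D : connection M).
Implicit Types (a b c : midx M) (x z : M).

Local Notation dom a := (cdom (mchart a)).
Lemma dtrans_differentiable a x : dom a x ->
  differentiable (dtrans (pref x) a) (pcrd x).
Proof.
move=> ax; exact: smooth_on_differentiable (@dtrans_smooth _ _ _ _ _) (overlap_crd (prefP x) ax).
Qed.

Lemma dtransV_differentiable a x : dom a x ->
  differentiable (dtransV (pref x) a) (pcrd x).
Proof.
move=> ax; exact: smooth_on_differentiable (@dtransV_smooth _ _ _ _ _) (overlap_crd (prefP x) ax).
Qed.

Lemma mul_dtransV a x : dom a x ->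
  dtrans (pref x) a (pcrd x) *m dtransV (pref x) a (pcrd x) = 1%:M.
Proof.
move=> ax; rewrite /pcrd (dtransV_crd a (prefP x)); exact: dtransK ax (prefP x).
Qed.

Lemma diff_dtransV a x w : dom a x ->
  dir_diff (dtransV (pref x) a) (pcrd x) w =
  - (dtransV (pref x) a (pcrd x) *m dir_diff (dtrans (pref x) a) (pcrd x) w
     *m dtransV (pref x) a (pcrd x)).
Proof.
move=> ax; apply: diff_mxinv.
- exact: dtrans_differentiable.
- exact: dtransV_differentiable.
apply: (near_loc (near_dom ax)) => z xz az.
by rewrite (dtransV_crd a xz) dtransK.
Qed.

(** [dtrans] is the Jacobian of [trans], so both sides are mixed second derivatives of [trans]. *)
Lemma diff_dtrans_sym a x w v : dom a x ->
  dir_diff (dtrans (pref x) a) (pcrd x) w *m v = dir_diff (dtrans (pref x) a) (pcrd x) v *m w.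
Proof.
move=> ax.
have ov := overlap_crd (prefP x) ax.
have H u u' : dir_diff (dtrans (pref x) a) (pcrd x) u *m u' =
    'd (fun y => 'd (trans (pref x) a) y u') (pcrd x) u.
  have d1 : is_diff (pcrd x) (fun y => dtrans (pref x) a y *m u')
      (fun h => dir_diff (dtrans (pref x) a) (pcrd x) h *m u').
    apply: is_diffW (is_diff_mulmx (is_diff_dir_diff (dtrans_differentiable ax))
      (is_diff_cst u' _)).
    by move=> h /=; rewrite mulmx0 add0r.
  have eqd : {near pcrd x, (fun y => dtrans (pref x) a y *m u') =1
      (fun y => 'd (trans (pref x) a) y u')}.
    apply: (near_loc (near_dom ax)) => z xz az.
    by rewrite (dtransE _ xz az).
  by have [_ ->] := is_diff_near_eq eqd d1.
rewrite !H; apply: (diff2_sym (U := overlap (pref x) a)) => //.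
  exact: overlap_open.
exact: trans_smooth.
Qed.

(** The usual law C = A G A^-1 - dA A^-1, where A is the Jacobian, B its inverse, and G, C are the
    Christoffel matrices in the two charts. *)
Lemma christoffel_change (A B dA dB G C : 'M[R]_n) : A *m B = 1%:M ->
  C = A *m (dB + G *m B) -> dB = - (B *m dA *m B) -> C = (A *m G - dA) *m B.
Proof.
by move=> AB -> ->; rewrite mulmxDr mulmxBl mulmxN !mulmxA AB mul1mx addrC.
Qed.

Lemma chart_christoffelE2 a x w : dom a x ->
  chart_christoffel D a x w =
  (dtrans (pref x) a (pcrd x) *m christoffel D x w
   - dir_diff (dtrans (pref x) a) (pcrd x) w) *m dtransV (pref x) a (pcrd x).
Proof.
move=> ax.
exact: (christoffel_change (mul_dtransV ax) (chart_christoffelE D w ax) (diff_dtransV w ax)).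
Qed.

Definition tors x (w v : 'cV[R]_n) : 'cV[R]_n :=
  christoffel D x w *m v - christoffel D x v *m w.

Lemma subr_addK (V : zmodType) (p q g h : V) : p + g - (q + h) - (p - q) = g - h.
Proof. by rewrite opprD addrACA [p - q + _]addrC addrK. Qed.

(** The derivatives of the components of X and Y cancel against the bracket, leaving a pointwise
    bilinear expression. *)
Lemma torsE x (X Y : vfield M) : vf_smooth_at x X -> vf_smooth_at x Y ->
  torsion D X Y x = tors x (X x) (Y x).
Proof.
move=> Xs Ys; rewrite /torsion /bracket /tors (covE D _ Xs) (covE D _ Ys).
exact: subr_addK.
Qed.

Lemma tors_linear x (c : R) u v w :
  tors x (c *: u + v) w = c *: tors x u w + tors x v w.
Proof.
rewrite /tors christoffelP mulmxDl mulmxDr -scalemxAl -scalemxAr scalerBr.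
by rewrite opprD addrACA.
Qed.

Lemma tors_alt x u v : tors x u v = - tors x v u.
Proof. by rewrite /tors opprB. Qed.

Lemma torsion_change (A B dA dA' G G' C C' : 'M[R]_n) (v w : 'cV[R]_n) :
  B *m A = 1%:M -> C = (A *m G - dA) *m B -> C' = (A *m G' - dA') *m B ->
  dA *m v = dA' *m w ->
  A *m (G *m v - G' *m w) = C *m (A *m v) - C' *m (A *m w).
Proof.
move=> BA -> -> dAv.
rewrite -!mulmxA [B *m (A *m v)]mulmxA [B *m (A *m w)]mulmxA BA !mul1mx.
by rewrite mulmxBr !mulmxBl dAv !mulmxA opprB addrA subrK.
Qed.

(** Tensoriality of the torsion: the inhomogeneous terms of the Christoffel law contribute dA(w) v -
    dA(v) w, which is zero by [diff_dtrans_sym]. *)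
Lemma tcomp_tors a x w v : dom a x ->
  tcomp a x (tors x w v) = chart_christoffel D a x w *m tcomp a x v
                         - chart_christoffel D a x v *m tcomp a x w.
Proof.
move=> ax; rewrite /tcomp /tors.
exact: (torsion_change (mulmx1C (mul_dtransV ax)) (chart_christoffelE2 w ax)
  (chart_christoffelE2 v ax) (diff_dtrans_sym w v ax)).
Qed.

(** A trace does not depend on the basis, so it may be computed in the frame of any chart [a] around
    [x]. With [a] fixed, the right side varies smoothly with [x]. *)
Lemma torsion_trace_chart a x w : dom a x ->
  torsion_trace (tors x) w = \sum_i \sum_k tcomp a x w k 0 *
    (tcomp a x (cov D x (frame a k x) (frame a i)) i 0
     - tcomp a x (cov D x (frame a i x) (frame a k)) i 0).
Proof.
move=> ax; have px := prefP x.
pose A := dtrans (pref x) a (pcrd x); pose B := dtransV (pref x) a (pcrd x).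
have AB : A *m B = 1%:M := mul_dtransV ax.
pose N : 'M[R]_n := christoffel D x w - \matrix_(k, i) (christoffel D x (delta_mx i 0) *m w) k 0.
have tN v : tors x w v = N *m v.
  rewrite /tors /N mulmxBl; congr (_ - _).
  have H (c : R) u u' : christoffel D x (c *: u + u') *m w = c *: (christoffel D x u *m w) + christoffel D x u' *m w.
    by rewrite christoffelP mulmxDl scalemxAl.
  pose g u := christoffel D x u *m w.
  have glin : linear g by move=> c u u'; exact: H.
  pose gL : {linear 'cV[R]_n -> 'cV[R]_n} := HB.pack g (GRing.isLinear.Build _ _ _ _ _ glin).
  rewrite -/(g v) -[g]/(gL : _ -> _) {1}[v]matrix_sum_delta linear_sum.
  apply/colP => k; rewrite summxE mxE; apply: eq_bigr => i _.
  by rewrite big_ord1 linearZ !mxE mulrC.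
have -> : torsion_trace (tors x) w = \tr N.
  apply: eq_bigr => i _; by rewrite tN -colE mxE.
have -> : \tr N = \tr (A *m N *m B).
  by rewrite mxtrace_mulC mulmxA (mulmx1C AB) mul1mx.
have ANB i : (A *m N *m B) *m delta_mx i 0 = tcomp a x (tors x w (frame a i x)).
  rewrite tN /tcomp -/A /frame -(dtransV_crd a px) -/(pcrd x) -/B.
  by rewrite !mulmxA.
rewrite /mxtrace; apply: eq_bigr => i _.
have -> : (A *m N *m B) i i = (A *m N *m B *m (delta_mx i 0 : 'cV_n)) i 0.
  by rewrite -colE [RHS]mxE.
rewrite ANB (tcomp_tors _ _ ax) (tcomp_frame i ax ax) (dtrans_id ax) mul1mx.
have ccE u k : (chart_christoffel D a x u *m (delta_mx k 0 : 'cV_n)) i 0 =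
    tcomp a x (cov D x u (frame a k)) i 0.
  by rewrite -colE !mxE.
have subE (u v : 'cV[R]_n) : (u - v) i 0 = u i 0 - v i 0 by rewrite !mxE.
rewrite subE ccE.
under [RHS]eq_bigr do rewrite mulrBr.
rewrite sumrB; congr (_ - _).
  rewrite {1}(frame_decomp w ax).
  pose g u := tcomp a x (cov D x u (frame a i)).
  have glin : linear g.
    move=> c u u'; rewrite /g cov_linear; last exact: frame_smooth.
    by rewrite /tcomp [LHS]mulmxDr scalemxAr.
  pose gL : {linear 'cV[R]_n -> 'cV[R]_n} := HB.pack g (GRing.isLinear.Build _ _ _ _ _ glin).
  rewrite -/(g _) -[g]/(gL : _ -> _) linear_sum summxE; apply: eq_bigr => k _.
  by rewrite linearZ mxE.
rewrite mxE; apply: eq_bigr => k _.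
by rewrite [LHS]mulrC; congr (_ * _); rewrite [LHS]mxE.
Qed.

Lemma fun_smoothM x (f g : M -> R) : fun_smooth_at x f -> fun_smooth_at x g ->
  fun_smooth_at x (fun z => f z * g z).
Proof. by move=> fs gs; exact: (smooth_nearZ fs gs). Qed.

Lemma fun_smoothD x (f g : M -> R) : fun_smooth_at x f -> fun_smooth_at x g ->
  fun_smooth_at x (fun z => f z + g z).
Proof. by move=> fs gs; exact: (smooth_nearD fs gs). Qed.

Lemma fun_smoothB x (f g : M -> R) : fun_smooth_at x f -> fun_smooth_at x g ->
  fun_smooth_at x (fun z => f z - g z).
Proof.
move=> fs gs; apply: (@fun_smooth_near_eq _ _ _ _ (fun z => f z + (-1) * g z)).
  by apply: filterE => z; rewrite mulN1r.
by apply: fun_smoothD => //; apply: fun_smoothM => //; exact: fun_smooth_cst.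
Qed.

Lemma fun_smooth_sum x (I : Type) (r : seq I) (F : I -> M -> R) :
  (forall i, fun_smooth_at x (F i)) ->
  fun_smooth_at x (fun z => \sum_(i <- r) F i z).
Proof. by move=> Fs; exact: (smooth_near_sum r Fs). Qed.

Lemma torsion_trace_smooth x (X : vfield M) : vf_smooth_at x X ->
  fun_smooth_at x (fun z => torsion_trace (tors z) (X z)).
Proof.
move=> Xs.
(* The chart stays [pref x] while z varies, whereas [tors z] is written in the chart [pref z]. *)
pose F z := \sum_i \sum_k tcomp (pref x) z (X z) k 0 *
    (tcomp (pref x) z (cov D z (frame (pref x) k z) (frame (pref x) i)) i 0
     - tcomp (pref x) z (cov D z (frame (pref x) i z) (frame (pref x) k)) i 0).
apply: (@fun_smooth_near_eq _ _ _ _ F).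
  by apply: filterS (near_dom (prefP x)) => z xz; rewrite (torsion_trace_chart _ xz).
have fs i := frame_smooth i (prefP x).
do 2 (apply: fun_smooth_sum => ?).
apply: fun_smoothM; first exact: vf_smooth_comp.
by apply: fun_smoothB; apply: vf_smooth_comp; exact: cov_smooth.
Qed.

Section twist.

(* The connection D - beta (x) Id. *)
Variable beta : M -> 'cV[R]_n -> R.
Hypothesis beta_linear : forall x (c : R) u v,
  beta x (c *: u + v) = c * beta x u + beta x v.
Hypothesis beta_smooth : forall x (X : vfield M), vf_smooth_at x X ->
  fun_smooth_at x (fun z => beta z (X z)).

Let tcov x w (Y : vfield M) : 'cV[R]_n := cov D x w Y - beta x w *: Y x.

Lemma twist_linear x (Y : vfield M) : vf_smooth_at x Y ->
  forall (c : R) u v, tcov x (c *: u + v) Y = c *: tcov x u Y + tcov x v Y.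
Proof.
move=> Ys c u v; rewrite /tcov cov_linear // beta_linear.
by apply/colP => i; rewrite !mxE; ring.
Qed.

Lemma twist_add x v (Y Z : vfield M) : vf_smooth_at x Y -> vf_smooth_at x Z ->
  tcov x v (fun y => Y y + Z y) = tcov x v Y + tcov x v Z.
Proof.
move=> Ys Zs; rewrite /tcov cov_add //.
by apply/colP => i; rewrite !mxE; ring.
Qed.

Lemma twist_leibniz x v (f : M -> R) (Y : vfield M) :
  fun_smooth_at x f -> vf_smooth_at x Y ->
  tcov x v (fun y => f y *: Y y) = dfun x v f *: Y x + f x *: tcov x v Y.
Proof.
move=> fs Ys; rewrite /tcov cov_leibniz //.
by apply/colP => i; rewrite !mxE; ring.
Qed.

Lemma twist_smooth x (X Y : vfield M) : vf_smooth_at x X -> vf_smooth_at x Y ->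
  vf_smooth_at x (fun y => tcov y (X y) Y).
Proof.
move=> Xs Ys.
apply: (@vf_smooth_near_eq _ _ _ _
  (fun z => cov D z (X z) Y + (-1) *: (beta z (X z) *: Y z))).
  by apply: filterE => z; rewrite scaleN1r.
apply: vf_smoothD; first exact: cov_smooth.
apply: vf_smoothZ; first exact: fun_smooth_cst.
by apply: vf_smoothZ => //; exact: beta_smooth.
Qed.

Definition twist : connection M :=
  Connection twist_linear twist_add twist_leibniz twist_smooth.

Lemma pb_cov_twist (p : JM M) X s :
  pb_cov twist p X s = pb_cov D p X s - beta (jpi p) (dpi X) *: s p.
Proof.
rewrite /pb_cov /= -addrA; congr (_ + _).
have -> : beta (jpi p) (dpi X) *: s p =
    \sum_i s p i 0 *: (beta (jpi p) (dpi X) *: delta_mx i 0).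
  rewrite {1}(matrix_sum_delta (s p)) scaler_sumr; apply: eq_bigr => i _.
  by rewrite big_ord1 !scalerA mulrC.
rewrite -sumrB; apply: eq_bigr => i _.
by rewrite /tcov frame_pref scalerBr.
Qed.

(** The scalar endomorphism beta(w) Id drops out of the derivative of [tautJ], so the two sets of
    candidates coincide and [xget] picks the same element for every [X]. *)
Lemma Jnabla_twist : Jnabla twist = Jnabla D.
Proof.
have E p X : pb_cov_End twist p X (@tautJ _ _ M) = pb_cov_End D p X (@tautJ _ _ M).
  apply/matrixP => k i; rewrite [LHS]mxE [RHS]mxE; congr (fun_of_matrix _ _ _).
  rewrite /= !pb_cov_twist [_ *m (_ - _)]mulmxBr -scalemxAr.
  by rewrite opprB addrA subrK.
apply/funext => p; apply/funext => X; rewrite /Jnabla; congr xget.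
by apply/funext => X'; rewrite /is_Jnabla_at /= !E.
Qed.

Lemma torsion_twist x (X Y : vfield M) : vf_smooth_at x X -> vf_smooth_at x Y ->
  torsion twist X Y x =
  tors x (X x) (Y x) - (beta x (X x) *: Y x - beta x (Y x) *: X x).
Proof.
move=> Xs Ys; rewrite -torsE // /torsion /= /tcov.
by apply/colP => i; rewrite !mxE; ring.
Qed.

End twist.
End torsion_tensor.

(** * Calculus on J(M) *)

Section complex_structure_curve.
Context {R : realType} {n : nat}.
Implicit Types (A B j : 'M[R]_n).

Lemma is_diff_quadratic (W : normedModType R) (g : R^o -> W) (C : R) :
  (\forall t \near (0 : R^o), `|g t| <= C * (`|t| * `|t|)) -> is_diff (0 : R^o) g 0.
Proof.
move=> gC.
have g0 : g 0 = 0.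
  apply/eqP; rewrite -normr_le0; apply: le_trans (nbhs_singleton gC) _.
  by rewrite normr0 !mulr0.
have E : g \o shift 0 = cst (g 0) + (0 : R^o -> W) +o_ (0 : R^o) id.
  apply/eqaddoP => e e0 /=.
  have C1 : 0 < `|C| + 1 by rewrite ltr_wpDl.
  have tC : \forall t \near (0 : R^o), `|t| <= e / (`|C| + 1).
    by apply/nbhs0_le/divr_gt0.
  apply: filterS2 gC tC => t gt te; rewrite !fctE /= addr0 g0 addr0 subr0.
  apply: le_trans gt _; rewrite mulrA ler_wpM2r //.
  apply: le_trans (_ : (`|C| + 1) * `|t| <= _).
    by rewrite ler_wpM2r // (le_trans (ler_norm _)) // lerDl.
  by rewrite mulrC -ler_pdivlMr.
pose L0 : {linear R^o -> W} := \0.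
have L0c : continuous L0 by move=> z; exact: cvg_cst.
have Ed : 'd g 0 = L0 :> (R^o -> W) by exact: diff_unique L0c E.
by split; [apply/diff_locallyP; rewrite Ed; split | rewrite Ed].
Qed.

Lemma mulmx_bounded :
  exists2 k : R, 0 < k & forall A B, `|A *m B| <= k * `|A| * `|B|.
Proof. exact: (bilinear_schwarz (f := @mulmx R n n n) (@mulmx_continuous R n n n)). Qed.

(** For small t, right multiplication by t B at most halves norms. A kernel element X satisfies X =
    - t X B, hence vanishes; the inverse I satisfies I = 1 - t I B, hence has norm at most twice
    that of 1. *)
Lemma inv_one_add B : exists2 C : R, 0 <= C & \forall t \near (0 : R^o),
  1%:M + t *: B \in unitmx /\ `|invmx (1%:M + t *: B)| <= C.
Proof.
have [k k0 kP] := mulmx_bounded.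
exists (2 * `|1%:M : 'M[R]_n|); first by rewrite mulr_ge0.
have K0 : 0 < 2 * (k * `|B| + 1) by rewrite mulr_gt0 // ltr_wpDl // mulr_ge0 // ltW.
have : \forall t \near (0 : R^o), `|t| <= (2 * (k * `|B| + 1))^-1.
  by apply: nbhs0_le; rewrite invr_gt0.
apply: filterS => t tk.
have half (X : 'M[R]_n) : `|t *: (X *m B)| <= `|X| / 2.
  rewrite normrZ; apply: le_trans (_ : `|t| * (k * `|X| * `|B|) <= _).
    by rewrite ler_wpM2l // kP.
  apply: le_trans (_ : (2 * (k * `|B| + 1))^-1 * ((k * `|B| + 1) * `|X|) <= _).
    rewrite ler_pM // ?mulr_ge0 // ?(ltW k0) //.
    rewrite mulrAC ler_wpM2r // lerDl //.
  rewrite invfM -mulrA mulKf 1?mulrC //.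
  by rewrite gt_eqF // ltr_wpDl // mulr_ge0 // ltW.
have U : 1%:M + t *: B \in unitmx.
  rewrite -row_free_unit -kermx_eq0; set X := kermx _.
  have /eqP : X *m (1%:M + t *: B) = 0 by exact: mulmx_ker.
  rewrite mulmxDr mulmx1 -scalemxAr addr_eq0 => /eqP XE.
  have := half X; rewrite -normrN -XE => X2.
  rewrite -normr_le0; have := normr_ge0 X; lra.
split=> //; set I := invmx _.
have IE : I = 1%:M - t *: (I *m B).
  have : I *m (1%:M + t *: B) = 1%:M by exact: mulVmx.
  by rewrite mulmxDr mulmx1 -scalemxAr => <-; rewrite addrK.
have : `|I| <= `|1%:M : 'M[R]_n| + `|I| / 2.
  rewrite {1}IE; apply: le_trans (ler_normB _ _) _; rewrite lerD2l //.
lra.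
Qed.

(* The curve t |-> (1 + t B) j (1 + t B)^-1 with B = j A / 2, whose velocity at
   t = 0 is [B, j] = A. *)
Lemma complex_structure_curve j A : j *m j = - 1%:M -> j *m A + A *m j = 0 ->
  exists c : R^o -> 'M[R]_n, [/\ c 0 = j, is_diff (0 : R^o) c (fun t => t *: A) &
    \forall t \near (0 : R^o), c t *m c t = - 1%:M].
Proof.
move=> jj jA; pose B := 2^-1 *: (j *m A).
have [C C0 CP] := inv_one_add B.
pose I (t : R^o) := invmx (1%:M + t *: B).
have [k k0 kP] := mulmx_bounded.
have dI : is_diff (0 : R^o) I (fun t => - (t *: B)).
  (* Exactly I = 1 - t B + g, and the bound on I makes g quadratic in t. *)
  pose g (t : R^o) := (t * t) *: (B *m B *m I t).
  have dg : is_diff (0 : R^o) g 0.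
    apply: (@is_diff_quadratic _ _ (k * `|B *m B| * C)).
    apply: filterS CP => t [_ tC]; rewrite /g normrZ normrM mulrC.
    rewrite ler_wpM2r ?mulr_ge0 //; apply: le_trans (kP _ _) _.
    by rewrite ler_wpM2l // mulr_ge0 // ltW.
  have dl : is_diff (0 : R^o) (fun t : R^o => t *: B) (fun t => t *: B).
    exact: is_diff_scalel.
  have d1 := is_diffD (is_diffB (is_diff_cst (1%:M : 'M[R]_n) (0 : R^o)) dl) dg.
  apply: is_diff_near_eq (is_diffW _ d1); last first.
    by move=> t; rewrite !fctE sub0r addr0.
  apply: filterS CP => t [tU _]; rewrite !fctE /g.
  have BI : t *: (B *m I t) = 1%:M - I t.
    apply/eqP; rewrite eq_sym subr_eq addrC scalemxAl -{1}[I t]mul1mx -mulmxDl.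
    by rewrite mulmxV.
  rewrite -scalerA -mulmxA scalemxAr BI mulmxBr mulmx1 scalerBr BI.
  by rewrite addrA subrK opprB addrC subrK.
have I0 : I 0 = 1%:M by rewrite /I scale0r addr0 invmx1.
have jAj : j *m A *m j = A.
  have /eqP := jA; rewrite addr_eq0 => /eqP jAN.
  by rewrite jAN mulNmx -mulmxA jj mulmxN mulmx1 opprK.
have jjA : j *m (j *m A) = - A by rewrite mulmxA jj mulNmx mul1mx.
exists (fun t => (1%:M + t *: B) *m j *m I t); split.
- by rewrite I0 scale0r addr0 mul1mx mulmx1.
- have dl : is_diff (0 : R^o) (fun t : R^o => t *: B) (fun t => t *: B).
    exact: is_diff_scalel.
  have d1 := is_diffD (is_diff_cst (1%:M : 'M[R]_n) (0 : R^o)) dl.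
  have d2 := is_diff_mulmx (is_diff_mulmx d1 (is_diff_cst j (0 : R^o))) dI.
  apply: is_diffW d2 => t; rewrite !fctE I0 scale0r addr0 mul1mx mulmx1 !mulmx0.
  rewrite !add0r mulmxN -scalemxAr -scalemxAl -scalerN -scalerDr; congr (_ *: _).
  rewrite /B -scalemxAr -scalemxAl jAj jjA scalerN opprK -scalerDl.
  by rewrite (_ : 2^-1 + 2^-1 = 1 :> R) ?scale1r //; lra.
- apply: filterS CP => t [tU _]; rewrite -/(I t).
  have IE : I t *m (1%:M + t *: B) = 1%:M by exact: mulVmx.
  have EI : (1%:M + t *: B) *m I t = 1%:M by exact: mulmxV.
  move: (1%:M + t *: B) (I t) IE EI => E I' IE EI.
  rewrite !mulmxA -[E *m j *m I' *m E]mulmxA IE mulmx1 -[E *m j *m j]mulmxA jj.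
  by rewrite mulmxN mulmx1 mulNmx EI.
Qed.

End complex_structure_curve.

(** * Points, tangent vectors and derivatives on J(M) in charts *)

Section twistor.
Context {R : realType} {n : nat} (M : manifold R n).
Implicit Types (a b c : midx M) (x z : M) (p q : JM M) (X Y : jmod R n).

Local Notation dom a := (cdom (mchart a)).
Lemma jend_sqr q : jend q *m jend q = - 1%:M.
Proof. exact/eqP/jendP. Qed.

Lemma jcrdE a q : jcrd a q = (trans (pref (jpi q)) a (pcrd (jpi q)),
  dtrans (pref (jpi q)) a (pcrd (jpi q)) *m jend q
    *m dtransV (pref (jpi q)) a (pcrd (jpi q))).
Proof. by []. Qed.

Lemma jcrd1 a q : (jcrd a q).1 = crd a (jpi q).
Proof. by rewrite jcrdE /= /pcrd (trans_crd a (prefP (jpi q))). Qed.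

Lemma conj_sqr (A B j : 'M[R]_n) : B *m A = 1%:M -> A *m B = 1%:M ->
  j *m j = - 1%:M -> (A *m j *m B) *m (A *m j *m B) = - 1%:M.
Proof.
move=> BA AB jj; rewrite !mulmxA -[A *m j *m B *m A]mulmxA BA mulmx1.
by rewrite -[A *m j *m j]mulmxA jj mulmxN mulmx1 mulNmx AB.
Qed.

Lemma conj_conj (A B j : 'M[R]_n) : A *m B = 1%:M ->
  A *m (B *m j *m A) *m B = j.
Proof. by move=> AB; rewrite !mulmxA AB mul1mx -mulmxA AB mulmx1. Qed.

Lemma jcrd_sqr a q : dom a (jpi q) -> (jcrd a q).2 *m (jcrd a q).2 = - 1%:M.
Proof.
move=> aq; rewrite jcrdE; have AB := mul_dtransV aq.
exact: conj_sqr (mulmx1C AB) AB (jend_sqr q).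
Qed.

Lemma jcrd_pref p : jcrd (pref (jpi p)) p = jpcrd p.
Proof.
have px := prefP (jpi p); rewrite jcrdE /jpcrd /pcrd (trans_crd _ px).
by rewrite (dtransV_crd _ px) (dtrans_id px) mul1mx mulmx1.
Qed.

Lemma ex_jpoint a z (j : 'M[R]_n) : dom a z -> j *m j = - 1%:M ->
  exists2 q, jpi q = z & jcrd a q = (crd a z, j).
Proof.
move=> az jj; have pz := prefP z.
have AB := mul_dtransV az.
have sq := conj_sqr AB (mulmx1C AB) jj.
exists (JPoint z (introT eqP sq)) => //; rewrite jcrdE /=; congr pair.
  by rewrite /pcrd (trans_crd a pz).
exact: conj_conj AB.
Qed.

Lemma is_diff_pairW (V W1 W2 : normedModType R) (f df : V -> W1) (g dg : V -> W2) (x : V) :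
  is_diff x f df -> is_diff x g dg ->
  is_diff x (fun y => (f y, g y)) (fun v => (df v, dg v)).
Proof. by move=> ? ?; exact: is_diff_pair. Qed.

(* X is the velocity of a curve in J(M), along which F vanishes. *)
Lemma diff_vanish (W : normedModType R) p X (F : jmod R n -> W) (O : set (jmod R n)) :
  open O -> O (jpcrd p) -> differentiable F (jpcrd p) -> jtangent p X ->
  (forall q, dom (pref (jpi p)) (jpi q) -> O (jcrd (pref (jpi p)) q) ->
     F (jcrd (pref (jpi p)) q) = 0) ->
  'd F (jpcrd p) X = 0.
Proof.
move=> Oo Op Fd Xt F0; set a := pref (jpi p).
have [c [c0 dc cc]] := complex_structure_curve (jend_sqr p) Xt.
pose y (t : R^o) := t *: X.1 + pcrd (jpi p).
have dy : is_diff (0 : R^o) y (fun t : R^o => t *: X.1).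
  apply: is_diffW (is_diffD (is_diff_scalel (0 : R^o) X.1) (is_diff_cst (pcrd (jpi p)) _)).
  by move=> t; rewrite fctE addr0.
pose g (t : R^o) : jmod R n := (y t, c t).
have dg : is_diff (0 : R^o) g (fun t => t *: X).
  by apply: is_diffW (is_diff_pairW dy dc) => t; case: (X).
have g0 : g 0 = jpcrd p by rewrite /g /y scale0r add0r c0.
have gc : {for (0 : R^o), continuous g}.
  by apply: differentiable_continuous; have [] := dg.
have yc : {for (0 : R^o), continuous y}.
  by apply: differentiable_continuous; have [] := dy.
have dF : is_diff (g 0) F ('d F (jpcrd p)) by rewrite g0; exact: differentiableP.
have dFg := is_diff_comp dg dF.
have d0 : is_diff (0 : R^o) (F \o g) 0.
  apply: is_diff_near_eq (is_diff_cst (0 : W) (0 : R^o)).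
  have nO : nbhs (g 0) O by rewrite g0; exact: open_nbhs_nbhs.
  have nOt : \forall t \near (0 : R^o), O (g t) := gc _ nO.
  have ny : \forall w \near y 0, exists z, [/\ dom a z, setT z & w = crd a z].
    rewrite /y scale0r add0r; exact: near_chart (prefP (jpi p)) filterT.
  have nyt : \forall t \near (0 : R^o), exists z, [/\ dom a z, setT z & y t = crd a z] := yc _ ny.
  apply: filterS3 nOt nyt cc => t Ogt [z [az _ yz]] ct /=.
  have [q qz qE] := ex_jpoint az ct.
  have -> : g t = jcrd a q by rewrite qE /g yz.
  by rewrite F0 //; [rewrite qz|rewrite qE -yz].
have := is_diff_inj dFg d0 1; rewrite /= scale1r.
by [].
Qed.

Lemma jextends_differentiable (W : normedModType R) p (f : JM M -> W) F :
  jextends p f F -> differentiable F (jpcrd p).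
Proof. by move=> [U [Oo Op Fs _]]; exact: smooth_on_differentiable Fs Op. Qed.

(** Two extensions of [f] differ by a function that vanishes on J(M) near p, whose derivative along
    tangent vectors is 0 by [diff_vanish]. The extension chosen by [xget] is therefore
    immaterial. *)
Lemma jderE (W : normedModType R) p X (f : JM M -> W) F :
  jtangent p X -> jextends p f F -> jder p X f = 'd F (jpcrd p) X.
Proof.
move=> Xt Fe; rewrite /jder.
have Ge : jextends p f (xget (fun=> 0) [set F | jextends p f F]).
  by have := @xgetPex _ (fun=> 0) [set F | jextends p f F] (ex_intro _ F Fe).
move: (xget _ _) Ge => G Ge.
have Fd := jextends_differentiable Fe; have Gd := jextends_differentiable Ge.
have [U [Oo Op _ Of]] := Fe; have [U' [Vo Vp _ Vf]] := Ge.
have dGF := is_diffB (differentiableP Gd) (differentiableP Fd).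
have [GFd GFE] := dGF.
have : 'd (G - F) (jpcrd p) X = 0.
  apply: (@diff_vanish _ p X (G - F) (U `&` U')) => //; first exact: openI.
  by move=> q aq [Uq Vq]; rewrite !fctE -Of // -Vf // subrr.
rewrite GFE => /eqP; rewrite subr_eq0 => /eqP.
by [].
Qed.

Lemma jextends_intro (W : normedModType R) p (f : JM M -> W) F (O : set (jmod R n)) :
  open O -> O (jpcrd p) -> smooth_on O F ->
  (forall q, dom (pref (jpi p)) (jpi q) -> O (jcrd (pref (jpi p)) q) ->
     f q = F (jcrd (pref (jpi p)) q)) -> jextends p f F.
Proof. by move=> Oo Op Fs fF; exists O. Qed.

Lemma snd_mulmx_smooth (O : set (jmod R n)) (v : 'cV[R]_n) : open O ->
  smooth_on O (fun X : jmod R n => X.2 *m v).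
Proof.
move=> Oo; apply: smooth_on_mulmx => //; last exact: smooth_on_cst.
have sc : continuous (snd : jmod R n -> 'M[R]_n) by move=> X; exact: cvg_snd.
by move=> k; exact: (Ck_on_lin (L := snd) Oo sc (Ck_on_id k Oo)).
Qed.

Lemma diff_snd_mulmx (v : 'cV[R]_n) (z : jmod R n) :
  is_diff z (fun X : jmod R n => X.2 *m v) (fun X => X.2 *m v).
Proof.
have sc : continuous (snd : jmod R n -> 'M[R]_n) by move=> X; exact: cvg_snd.
apply: is_diffW (is_diff_mulmx (is_diff_lin (L := snd) z sc) (is_diff_cst v z)).
by move=> X; rewrite mulmx0 add0r.
Qed.

Lemma tcomp_jend a q (v w : 'cV[R]_n) : dom a (jpi q) ->
  tcomp a (jpi q) v = w ->
  tcomp a (jpi q) (jend q *m v) = (jcrd a q).2 *m w.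
Proof.
move=> aq <-; rewrite jcrdE /tcomp /=; have := mulmx1C (mul_dtransV aq).
move: (dtrans _ _ _) (dtransV _ _ _) => A B BA.
by rewrite -!mulmxA; congr (_ *m (_ *m _)); rewrite mulmxA BA mul1mx.
Qed.

End twistor.

(** * Explicit formula for J^D *)

Section Jnabla_formula.
Context {R : realType} {n : nat} (M : manifold R n) (D : connection M).
Implicit Types (a b c : midx M) (x z : M) (p q : JM M) (X Y : jmod R n).

Local Notation dom a := (cdom (mchart a)).
Definition com (A B : 'M[R]_n) : 'M[R]_n := A *m B - B *m A.

Lemma tcomp_frame_pref p q i : dom (pref (jpi p)) (jpi q) ->
  tcomp (pref (jpi p)) (jpi q) (frame (pref (jpi p)) i (jpi q)) = delta_mx i 0.
Proof. by move=> pq; rewrite (tcomp_frame i pq pq) (dtrans_id pq) mul1mx. Qed.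

Lemma pb_cov_frame p X i : jtangent p X ->
  pb_cov D p X (pull (frame (pref (jpi p)) i)) =
  christoffel D (jpi p) X.1 *m delta_mx i 0.
Proof.
move=> Xt; rewrite /pb_cov christoffelE /pull frame_pref -[RHS]add0r; congr (_ + _).
rewrite (jderE (F := fun=> delta_mx i 0) Xt).
  by have [_ ->] := is_diff_cst (delta_mx i 0 : 'cV[R]_n) (jpcrd p).
apply: (jextends_intro (O := setT)) => //; [exact: openT|exact/smooth_on_cst/openT|].
by move=> q pq _; exact: tcomp_frame_pref.
Qed.

Lemma pb_cov_jframe p X i : jtangent p X ->
  pb_cov D p X (fun q => tautJ q *m pull (frame (pref (jpi p)) i) q) =
  X.2 *m delta_mx i 0 + christoffel D (jpi p) X.1 *m (jend p *m delta_mx i 0).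
Proof.
move=> Xt; rewrite /pb_cov christoffelE /pull frame_pref; congr (_ + _).
rewrite (jderE (F := fun Z : jmod R n => Z.2 *m (delta_mx i 0 : 'cV[R]_n)) Xt).
  by have [_ ->] := diff_snd_mulmx (delta_mx i 0 : 'cV[R]_n) (jpcrd p).
apply: (jextends_intro (O := setT)) => //; [exact: openT|exact/snd_mulmx_smooth/openT|].
by move=> q pq _; exact: tcomp_jend pq (tcomp_frame_pref i pq).
Qed.

(** Use (D_X J) e_i = D_X (J e_i) - J (D_X e_i). The e_i have constant components in their own
    chart, those of J e_i are linear in the matrix coordinate with derivative [X.2 *m e_i], and the
    Christoffel terms form the commutator. *)
Lemma pb_cov_EndE p X : jtangent p X ->
  pb_cov_End D p X (@tautJ _ _ M) = X.2 + com (christoffel D (jpi p) X.1) (jend p).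
Proof.
move=> Xt; apply: mulmx_inj => v.
suff H i : pb_cov_End D p X (@tautJ _ _ M) *m (delta_mx i 0 : 'cV_n) =
    (X.2 + com (christoffel D (jpi p) X.1) (jend p)) *m (delta_mx i 0 : 'cV_n).
  rewrite [v]matrix_sum_delta !mulmx_sumr; apply: eq_bigr => i _.
  by rewrite big_ord1 -!scalemxAr H.
have -> : pb_cov_End D p X (@tautJ _ _ M) *m (delta_mx i 0 : 'cV_n) =
    pb_cov D p X (fun q => tautJ q *m pull (frame (pref (jpi p)) i) q)
    - jend p *m pb_cov D p X (pull (frame (pref (jpi p)) i)).
  by rewrite -colE; apply/colP => k; rewrite !mxE.
rewrite (pb_cov_frame i Xt) (pb_cov_jframe i Xt) /com.
by rewrite mulmxDl mulmxBl !mulmxA addrA.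
Qed.

(* J^D X for X = (w, A): the equation on the vertical part is solved for A'. *)
Definition Jformula p X : jmod R n :=
  (jend p *m X.1, jend p *m (X.2 + com (christoffel D (jpi p) X.1) (jend p))
     - com (christoffel D (jpi p) (jend p *m X.1)) (jend p)).

(** The sum is, up to order, the derivation rule for [G, j^2], and j^2 = -1 is central. *)
Lemma com_anti (G j : 'M[R]_n) : j *m j = - 1%:M -> j *m com G j + com G j *m j = 0.
Proof.
move=> jj; rewrite /com mulmxBr mulmxBl !mulmxA jj -[G *m j *m j]mulmxA jj.
by rewrite mulmxN mulmx1 mulNmx mul1mx; apply/matrixP => i k; rewrite !mxE; ring.
Qed.

Lemma anti_mul (j A : 'M[R]_n) : j *m A + A *m j = 0 ->
  j *m (j *m A) + j *m A *m j = 0.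
Proof. by move=> jA; rewrite -[j *m A *m j]mulmxA -mulmxDr jA mulmx0. Qed.

Lemma Jformula_tangent p X : jtangent p X -> jtangent p (Jformula p X).
Proof.
rewrite /jtangent /= => Xt; have jj := jend_sqr p.
set G := christoffel _ _ _; set G' := christoffel _ _ _.
have E1 := com_anti G jj; have E2 := com_anti G' jj.
have E3 := anti_mul Xt; have E4 := anti_mul E1.
move: (com G _) (com G' _) E1 E2 E3 E4 => C C' E1 E2 E3 E4.
rewrite mulmxBr mulmxBl mulmxDr mulmxDr mulmxDl.
have -> (a b c d e f : 'M[R]_n) : a + b - c + (d + e - f) = (a + d) + (b + e) - (c + f).
  by rewrite opprD !addrA; apply/matrixP => i k; rewrite !mxE; ring.
by rewrite E2 E3 E4 !addr0 subr0.
Qed.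

(** The two equations determine X' in closed form, and this value is admissible by
    [Jformula_tangent]; so the choice made by [xget] is forced. *)
Lemma JnablaE p X : jtangent p X -> Jnabla D p X = Jformula p X.
Proof.
move=> Xt; have Jt := Jformula_tangent Xt.
have H X' : is_Jnabla_at D p X X' <-> X' = Jformula p X.
  split=> [[X't X'1 X'2]|->].
    move: X'2; rewrite !pb_cov_EndE // /tautJ /dpi in X'1 * => X'2.
    rewrite (surjective_pairing X') /Jformula; congr pair; first exact: X'1.
    by rewrite -X'2 X'1 addrK.
  split=> //; rewrite !pb_cov_EndE //= subrK.
  by [].
have : is_Jnabla_at D p X (Jnabla D p X).
  apply: (@xgetPex _ 0 [set X' | is_Jnabla_at D p X X']).
  by exists (Jformula p X); apply/H.
by move/H.
Qed.

End Jnabla_formula.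

(** * Horizontal lifts and the Nijenhuis tensor *)

Section horizontal.
Context {R : realType} {n : nat} (M : manifold R n) (D : connection M).
Implicit Types (a b c : midx M) (x z : M) (p q : JM M) (X Y : jmod R n).

Local Notation dom a := (cdom (mchart a)).
Lemma etrans_diff a q : dom a (jpi q) ->
  is_diff (jpcrd q) (etrans (pref (jpi q)) a : jmod R n -> jmod R n)
    (fun X => (dtrans (pref (jpi q)) a (pcrd (jpi q)) *m X.1,
      dtrans (pref (jpi q)) a (pcrd (jpi q)) *m jend q
         *m dir_diff (dtransV (pref (jpi q)) a) (pcrd (jpi q)) X.1
      + (dtrans (pref (jpi q)) a (pcrd (jpi q)) *m X.2
         + dir_diff (dtrans (pref (jpi q)) a) (pcrd (jpi q)) X.1 *m jend q)
         *m dtransV (pref (jpi q)) a (pcrd (jpi q)))).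
Proof.
move=> aq; have px := prefP (jpi q); apply: is_diff_pairW.
  by apply: (is_diff_fst (z := jpcrd q)); exact: trans_diff px aq.
have dA := is_diff_fst (z := jpcrd q) (is_diff_dir_diff (dtrans_differentiable aq)).
have dB := is_diff_fst (z := jpcrd q) (is_diff_dir_diff (dtransV_differentiable aq)).
exact: (is_diff_mulmx (is_diff_mulmx dA (is_diff_snd (jpcrd q))) dB).
Qed.

(** The vertical part is chosen so that the expression in [pb_cov_EndE] vanishes: the lift lies in
    the kernel of the covariant derivative of [tautJ]. *)
Definition hlift q (w : 'cV[R]_n) : jmod R n :=
  (w, - com (christoffel D (jpi q) w) (jend q)).

Lemma hlift_tangent q w : jtangent q (hlift q w).
Proof.
rewrite /jtangent /hlift /= mulmxN mulNmx -opprD.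
by rewrite (com_anti _ (jend_sqr q)) oppr0.
Qed.

Lemma Jnabla_hlift q w : Jnabla D q (hlift q w) = hlift q (jend q *m w).
Proof.
rewrite (JnablaE D (hlift_tangent q w)) /Jformula /hlift /=.
by rewrite addNr mulmx0 sub0r.
Qed.

Lemma hlift_change (A B G C dA dB j : 'M[R]_n) :
  B *m A = 1%:M -> C = (A *m G - dA) *m B -> dB = - (B *m dA *m B) ->
  A *m j *m dB + (A *m (- com G j) + dA *m j) *m B = - com C (A *m j *m B).
Proof.
move=> BA -> ->; rewrite /com !mulmxN.
have -> : (A *m G - dA) *m B *m (A *m j *m B) = (A *m G - dA) *m j *m B.
  by rewrite !mulmxA -[_ *m B *m A]mulmxA BA mulmx1.
have -> : A *m j *m B *m ((A *m G - dA) *m B) = (A *m j *m G - A *m j *m B *m dA) *m B.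
  rewrite !mulmxA mulmxBr !mulmxA -[A *m j *m B *m A]mulmxA BA mulmx1.
  by [].
rewrite opprB mulmxDl mulNmx mulmxBr !mulmxBl opprB !mulmxA.
by apply/matrixP => i k; rewrite !mxE; ring.
Qed.

(** Horizontal lifts are independent of the chart: the derivatives of the Jacobian and its inverse
    in the differential of A j A^-1 match the inhomogeneous term of the Christoffel law. *)
Lemma jvf_comp_hlift a q w : dom a (jpi q) ->
  'd (etrans (pref (jpi q)) a : jmod R n -> jmod R n) (jpcrd q) (hlift q w) =
  (tcomp a (jpi q) w, - com (chart_christoffel D a (jpi q) w) (jcrd a q).2).
Proof.
move=> aq; have [_ ->] := etrans_diff aq; rewrite jcrdE /=; congr pair.
exact: (hlift_change _ (mulmx1C (mul_dtransV aq)) (chart_christoffelE2 D w aq)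
  (diff_dtransV w aq)).
Qed.

Lemma tcompP a x (c : R) u v :
  tcomp a x (c *: u + v) = c *: tcomp a x u + tcomp a x v.
Proof. by rewrite /tcomp [LHS]mulmxDr scalemxAr. Qed.

Lemma chart_christoffel_sum a x w : dom a x ->
  chart_christoffel D a x w =
  \sum_k tcomp a x w k 0 *: chart_christoffel D a x (frame a k x).
Proof.
move=> ax.
have glin : linear (chart_christoffel D a x).
  have cE l i u : chart_christoffel D a x u l i = tcomp a x (cov D x u (frame a i)) l 0.
    by rewrite [LHS]mxE.
  move=> c u v; apply/matrixP => k i; rewrite cE (cov_linear D (frame_smooth i ax)).
  rewrite tcompP [LHS]mxE [X in X + _ = _]mxE [RHS]mxE [X in _ = X + _]mxE !cE.
  by [].
pose gL : {linear 'cV[R]_n -> 'M[R]_n} :=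
  HB.pack (chart_christoffel D a x) (GRing.isLinear.Build _ _ _ _ _ glin).
have gE u : chart_christoffel D a x u = gL u by [].
rewrite {1}(frame_decomp w ax) gE linear_sum; apply: eq_bigr => k _.
by rewrite linearZ.
Qed.

Lemma chart_christoffel_pref x w :
  chart_christoffel D (pref x) x w = christoffel D x w.
Proof. by apply/matrixP => k i; rewrite [LHS]mxE [RHS]mxE tcomp_pref. Qed.

(* [christoffel_loc x y W]: the Christoffel matrix along W, in the coordinates
   of [pref x], at the point with coordinates y. *)
Definition christoffel_loc x (y W : 'cV[R]_n) : 'M[R]_n :=
  \sum_k W k 0 *: \sum_i
    vf_loc x (fun z => cov D z (frame (pref x) k z) (frame (pref x) i)) y
    *m (delta_mx 0 i : 'rV[R]_n).

Lemma christoffel_loc_crd x z w : dom (pref x) z ->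
  christoffel_loc x (crd (pref x) z) (tcomp (pref x) z w) =
  chart_christoffel D (pref x) z w.
Proof.
move=> xz; rewrite (chart_christoffel_sum w xz); apply: eq_bigr => k _.
congr (_ *: _); apply/matrixP => l j; rewrite summxE [RHS]mxE.
rewrite (bigD1 j) //= big1 ?addr0 => [|i ij].
  by rewrite vf_loc_crd // mxE big_ord1 [delta_mx _ _ _ _]mxE !eqxx mulr1.
by rewrite mxE big_ord1 [delta_mx _ _ _ _]mxE eq_sym (eq_sym j) (negbTE ij) andbF mulr0.
Qed.

Lemma christoffel_loc_smooth p (S : jmod R n -> 'cV[R]_n) :
  smooth_near (jpcrd p) S ->
  smooth_near (jpcrd p) (fun Z : jmod R n => christoffel_loc (jpi p) Z.1 (S Z)).
Proof.
move=> Ss; apply: smooth_near_sum => k; apply: smooth_nearZ.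
  exact: smooth_near_coord.
apply: smooth_near_sum => i; apply: smooth_near_mulmx; last exact: smooth_near_cst.
apply: (smooth_near_proj1 (x := jpcrd p)).
have fs l := frame_smooth l (prefP (jpi p)).
exact: cov_smooth.
Qed.

(** The formula for a horizontal lift in the coordinates around p, taken at all matrices [Z.2], even
    those whose square is not -1: this is the ambient extension that [jextends] asks for. *)
Definition hext p (S : jmod R n -> 'cV[R]_n) (Z : jmod R n) : jmod R n :=
  (S Z, - com (christoffel_loc (jpi p) Z.1 (S Z)) Z.2).

Lemma hext_smooth p S : smooth_near (jpcrd p) S -> smooth_near (jpcrd p) (hext p S).
Proof.
move=> Ss; apply: smooth_near_pair => //; apply: smooth_nearN.
have Cs := christoffel_loc_smooth Ss; have s2 := smooth_near_snd (jpcrd p).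
by apply: smooth_nearB; exact: smooth_near_mulmx.
Qed.

(* S expresses the section s of E in the coordinates around p. *)
Definition sec_ext p (s : Esection M) (S : jmod R n -> 'cV[R]_n) : Prop :=
  smooth_near (jpcrd p) S /\
  forall q, dom (pref (jpi p)) (jpi q) ->
    tcomp (pref (jpi p)) (jpi q) (s q) = S (jcrd (pref (jpi p)) q).

Definition hfield (s : Esection M) : jvfield M := fun q => hlift q (s q).

Lemma hfield_comp p s S q : sec_ext p s S -> dom (pref (jpi p)) (jpi q) ->
  jvf_comp (pref (jpi p)) (hfield s) q = hext p S (jcrd (pref (jpi p)) q).
Proof.
move=> [_ sS] pq; rewrite /jvf_comp /hfield (jvf_comp_hlift _ pq).
by rewrite /hext -(sS q pq) jcrd1 (christoffel_loc_crd _ pq).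
Qed.

Lemma hfield_extends p s S : sec_ext p s S ->
  jextends p (jvf_comp (pref (jpi p)) (hfield s)) (hext p S).
Proof.
move=> sS; have [U [Uo Up Us]] := hext_smooth sS.1.
by apply: jextends_intro Uo Up Us _ => q pq _; exact: hfield_comp.
Qed.

Lemma hfield_smooth p s S : sec_ext p s S -> jvf_smooth_at p (hfield s).
Proof.
move=> sS; split; first by move=> q; exact: hlift_tangent.
by exists (hext p S); exact: hfield_extends.
Qed.

Lemma hext_pcrd p s S : sec_ext p s S -> hext p S (jpcrd p) = hlift p (s p).
Proof.
move=> [_ sS]; have px := prefP (jpi p); have := sS p px.
rewrite jcrd_pref tcomp_pref => sE.
rewrite /hext /hlift -sE -[in christoffel_loc _ _ _](tcomp_pref (jpi p) (s p)).
by rewrite /jpcrd /= /pcrd (christoffel_loc_crd _ px) chart_christoffel_pref.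
Qed.

Lemma jbracket_hfield p s S t T : sec_ext p s S -> sec_ext p t T ->
  jbracket (hfield s) (hfield t) p =
  dir_diff (hext p T) (jpcrd p) (hlift p (s p))
  - dir_diff (hext p S) (jpcrd p) (hlift p (t p)).
Proof.
move=> sS tT; rewrite /jbracket.
rewrite (jderE (hlift_tangent p (s p)) (hfield_extends tT)).
by rewrite (jderE (hlift_tangent p (t p)) (hfield_extends sS)).
Qed.

Lemma hext_differentiable p s S : sec_ext p s S ->
  differentiable (hext p S) (jpcrd p).
Proof. by move=> sS; exact: smooth_near_differentiable (hext_smooth sS.1). Qed.

(** The first component of [hext] is S itself, so derivatives of Christoffel matrices appear only in
    the second component of the bracket. *)
Lemma jbracket_hfield1 p s S t T : sec_ext p s S -> sec_ext p t T ->
  (jbracket (hfield s) (hfield t) p).1 =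
  dir_diff T (jpcrd p) (hlift p (s p)) - dir_diff S (jpcrd p) (hlift p (t p)).
Proof.
move=> sS tT; rewrite (jbracket_hfield sS tT) /=.
by rewrite !dir_diff_fst //; [exact: hext_differentiable sS|exact: hext_differentiable tT].
Qed.

Lemma addr_eq0_shuffle (V : zmodType) (P Q U W : V) :
  P + Q + (U + W) = 0 -> P + W = - (Q + U).
Proof. by rewrite [U + W]addrC addrACA => /eqP; rewrite addr_eq0 => /eqP. Qed.

(* Differentiating j A(j) + A(j) j = 0 along X, A being the vertical part. *)
Lemma diff_hext_anti p s S X : sec_ext p s S -> jtangent p X ->
  let dS := (dir_diff (hext p S) (jpcrd p) X).2 in
  jend p *m dS + dS *m jend p =
  - (X.2 *m (hlift p (s p)).2 + (hlift p (s p)).2 *m X.2).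
Proof.
move=> sS Xt dS.
have dH := is_diff_comp_snd (is_diff_dir_diff (hext_differentiable sS)).
have d2 := is_diff_snd (jpcrd p).
have dF := is_diffD (is_diff_mulmx d2 dH) (is_diff_mulmx dH d2).
have [Fd FE] := dF.
have : 'd (((fun y : jmod R n => y.2 *m (hext p S y).2) : jmod R n -> 'M[R]_n)
      + (fun y : jmod R n => (hext p S y).2 *m y.2)) (jpcrd p) X = 0.
  apply: (@diff_vanish _ _ _ _ p X _ setT) => //; first exact: openT.
  move=> q pq _; rewrite fctE /hext /=.
  rewrite mulmxN mulNmx -opprD (com_anti _ (jcrd_sqr pq)).
  by rewrite oppr0.
rewrite FE !fctE (hext_pcrd sS) => E.
exact: (addr_eq0_shuffle E).
Qed.

Lemma anti_sub (j P Q A B : 'M[R]_n) :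
  j *m P + P *m j = - (A *m B + B *m A) ->
  j *m Q + Q *m j = - (B *m A + A *m B) ->
  j *m (P - Q) + (P - Q) *m j = 0.
Proof.
move=> E1 E2; rewrite mulmxBr mulmxBl addrACA -opprD E1 E2.
by rewrite [A *m B + _]addrC subrr.
Qed.

(** Brackets are computed with ambient extensions, so tangency to J(M) has to be proved before
    [JnablaE] can be applied to them. *)
Lemma jbracket_hfield_tangent p s S t T : sec_ext p s S -> sec_ext p t T ->
  jtangent p (jbracket (hfield s) (hfield t) p).
Proof.
move=> sS tT; rewrite (jbracket_hfield sS tT).
exact: (anti_sub (diff_hext_anti tT (hlift_tangent p (s p)))
  (diff_hext_anti sS (hlift_tangent p (t p)))).
Qed.

(** * The Nijenhuis tensor on lifts of constant fields *)

Section nijenhuis_horizontal.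
Variable p : JM M.
Local Notation a := (pref (jpi p)).
Local Notation j := (jend p).
Local Notation Gam := (christoffel D (jpi p)).

(* The vector field with constant components u in the chart of p. *)
Definition csec (u : 'cV[R]_n) : Esection M := fun q =>
  dtrans a (pref (jpi q)) (crd a (jpi q)) *m u.

Definition jsec (s : Esection M) : Esection M := fun q => jend q *m s q.

Lemma tcomp_csec u q : dom a (jpi q) -> tcomp a (jpi q) (csec u q) = u.
Proof.
move=> aq; rewrite /tcomp /csec /pcrd [LHS]mulmxA (dtransK aq (prefP (jpi q))).
by rewrite mul1mx.
Qed.

Lemma csec_pt u : csec u p = u.
Proof. by rewrite -[LHS](tcomp_pref (jpi p)) (tcomp_csec u (prefP (jpi p))). Qed.

Lemma csec_ext u : sec_ext p (csec u) (fun=> u).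
Proof. by split=> [|q aq]; [exact: smooth_near_cst|rewrite (tcomp_csec u aq)]. Qed.

Lemma jcsec_ext u : sec_ext p (jsec (csec u)) (fun Z => Z.2 *m u).
Proof.
split=> [|q aq]; last by exact: tcomp_jend aq (tcomp_csec u aq).
by apply: smooth_near_mulmx; [exact: smooth_near_snd|exact: smooth_near_cst].
Qed.

Lemma Jnabla_hfield s : (fun q => Jnabla D q (hfield s q)) = hfield (jsec s).
Proof. by apply/funext => q; rewrite /hfield Jnabla_hlift. Qed.

Lemma Jnabla1 X : jtangent p X -> (Jnabla D p X).1 = j *m X.1.
Proof. by move=> Xt; rewrite (JnablaE D Xt). Qed.

Lemma dir_diff_csec (u : 'cV[R]_n) (Z : jmod R n) :
  dir_diff (fun=> u : 'cV[R]_n) (jpcrd p) Z = 0.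
Proof. by rewrite (dir_diff_val _ (is_diff_cst u (jpcrd p))). Qed.

Lemma dir_diff_jcsec (u : 'cV[R]_n) (Z : jmod R n) :
  dir_diff (fun Z : jmod R n => Z.2 *m u) (jpcrd p) Z = Z.2 *m u.
Proof. by rewrite (dir_diff_val _ (diff_snd_mulmx u (jpcrd p))). Qed.

(** The left side lists the TM components of the four brackets, with J applied to the middle two.
    After expansion with J^2 = -1, the terms such as [Gju *m J *m v] regroup into torsions. *)
Lemma nijenhuis_tors (J Gu Gv Gju Gjv : 'M[R]_n) (u v : 'cV[R]_n) :
  J *m J = - 1%:M ->
  - com Gju J *m v - - com Gjv J *m u - J *m (0 - - com Gv J *m u)
    - J *m (- com Gu J *m v - 0) - (0 - 0) =
  Gu *m v - Gv *m u - (Gju *m (J *m v) - Gjv *m (J *m u))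
  + J *m (Gju *m v - Gv *m (J *m u)) + J *m (Gu *m (J *m v) - Gjv *m u).
Proof.
move=> JJ; rewrite /com !subr0 sub0r !(mulNmx, mulmxN, opprK) !mulmxBl !mulmxBr !mulmxA JJ.
rewrite !mulNmx !mul1mx.
move: (Gju *m J *m v) (J *m Gju *m v) (Gjv *m J *m u) (J *m Gjv *m u) (J *m Gv *m J *m u)
  (Gv *m u) (J *m Gu *m J *m v) (Gu *m v) => x1 x2 x3 x4 x5 x6 x7 x8.
by apply/colP => i; rewrite !mxE; ring.
Qed.

Lemma nijenhuisE (I : jendfield M) (X Y IX IY : jvfield M) q :
  (fun q => I q (X q)) = IX -> (fun q => I q (Y q)) = IY ->
  nijenhuis I X Y q = jbracket IX IY q - I q (jbracket IX Y q)
    - I q (jbracket X IY q) - jbracket X Y q.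
Proof. by move=> <- <-. Qed.

Lemma nijenhuis_fst (B1 B2 B3 B4 : jmod R n) (b1 b2 b3 b4 : 'cV[R]_n) :
  jtangent p B2 -> jtangent p B3 ->
  B1.1 = b1 -> B2.1 = b2 -> B3.1 = b3 -> B4.1 = b4 ->
  (B1 - Jnabla D p B2 - Jnabla D p B3 - B4).1 = b1 - j *m b2 - j *m b3 - b4.
Proof.
by move=> t2 t3 <- <- <- <-; rewrite -(Jnabla1 t2) -(Jnabla1 t3).
Qed.

Lemma nijenhuis_hfield1 u v :
  (nijenhuis (Jnabla D) (hfield (csec u)) (hfield (csec v)) p).1 =
  tors D (jpi p) u v - tors D (jpi p) (j *m u) (j *m v)
  + j *m tors D (jpi p) (j *m u) v + j *m tors D (jpi p) u (j *m v).
Proof.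
have eu := csec_ext u; have ev := csec_ext v.
have ju := jcsec_ext u; have jv := jcsec_ext v.
have t1 := jbracket_hfield_tangent ju ev; have t2 := jbracket_hfield_tangent eu jv.
have b1 := jbracket_hfield1 ju jv; have b2 := jbracket_hfield1 ju ev.
have b3 := jbracket_hfield1 eu jv; have b4 := jbracket_hfield1 eu ev.
(* Constant sections have derivative 0, while j u has derivative [Z.2 *m u] along Z, that is
   -[G(w), j] u on the lift of w. This is how the Christoffel matrices enter the TM component. *)
rewrite !dir_diff_jcsec /jsec !csec_pt in b1.
rewrite dir_diff_csec dir_diff_jcsec !csec_pt in b2.
rewrite dir_diff_csec dir_diff_jcsec !csec_pt in b3.
rewrite !dir_diff_csec in b4.
rewrite (nijenhuisE p (Jnabla_hfield (csec u)) (Jnabla_hfield (csec v))).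
rewrite (nijenhuis_fst t1 t2 b1 b2 b3 b4).
exact: nijenhuis_tors (jend_sqr p).
Qed.

End nijenhuis_horizontal.

End horizontal.

(** * The form alpha and the torsion-free connection *)

Section torsion_free_twist.
Context {R : realType} {m : nat} (M : manifold R (2 * m)%N) (D : connection M).

Definition torsion_form (x : M) (w : 'cV[R]_(2 * m)) : R :=
  ((2 * m)%:R - 1)^-1 * torsion_trace (tors D x) w.

Lemma torsion_form_linear x (c : R) u v :
  torsion_form x (c *: u + v) = c * torsion_form x u + torsion_form x v.
Proof.
rewrite /torsion_form mulrCA -mulrDr; congr (_ * _).
rewrite /torsion_trace mulr_sumr -big_split /=; apply: eq_bigr => i _.
have -> := tors_linear D x c u v (delta_mx i 0).
have cE (y z : 'cV[R]_(2 * m)) : (c *: y + z) i 0 = c * y i 0 + z i 0 by rewrite !mxE.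
exact: cE.
Qed.

Lemma torsion_form_smooth x (X : vfield M) : vf_smooth_at x X ->
  fun_smooth_at x (fun z => torsion_form z (X z)).
Proof.
by move=> Xs; apply: fun_smoothM; [exact: fun_smooth_cst|exact: torsion_trace_smooth].
Qed.

(** Each complex structure j of T_xM is a point of J(M) over x; integrability is used at that point,
    on the lifts of the constant fields u and v. *)
Lemma tors_integrable x (j : 'M[R]_(2 * m)) : nijenhuis_integrable (Jnabla D) ->
  j *m j = - 1%:M -> forall u v,
  tors D x u v - tors D x (j *m u) (j *m v) + j *m tors D x (j *m u) v
  + j *m tors D x u (j *m v) = 0.
Proof.
move=> DI jj u v; pose p := JPoint x (introT eqP jj).
rewrite -(nijenhuis_hfield1 D p u v).
by rewrite (DI p _ _ (hfield_smooth D (csec_ext p u)) (hfield_smooth D (csec_ext p v))).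
Qed.

Lemma tors_form x u v : (0 < m)%N -> nijenhuis_integrable (Jnabla D) ->
  tors D x u v = torsion_form x u *: v - torsion_form x v *: u.
Proof.
move=> m0 DI.
have H := torsion_trace_form (tors_linear D x) (tors_alt D x)
  (fun j jj => tors_integrable x DI jj) u v.
have n1 : (2 * m)%:R - 1 != 0 :> R.
  by rewrite subr_eq0 pnatr_eq1; case: m m0 => [|[|k]].
rewrite /torsion_form -!scalerA -scalerBr.
by apply: (canRL (scalerK n1)); exact: H.
Qed.

End torsion_free_twist.

Theorem theorem4p3 (R : realType) (m : nat) (hm : (0 < m)%N)
    (M : manifold R (2 * m)%N) (D : connection M) :
  nijenhuis_integrable (Jnabla D) ->
  exists D' : connection M,
    torsion_free D' /\
    (forall (p : JM M) (X : jmod R (2 * m)%N),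
       jtangent p X -> Jnabla D' p X = Jnabla D p X).
Proof.
move=> DI.
exists (twist D (torsion_form_linear D) (torsion_form_smooth D)); split.
  move=> x X Y Xs Ys; rewrite torsion_twist //.
  by rewrite (tors_form _ _ _ hm DI) subrr.
by move=> p X _; rewrite Jnabla_twist.
Qed.
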